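(* Let $\mathcal{S}=\sum^{\oplus}_{i\in I}\mathcal{S}_i$, where each $\mathcal{S}_i$ is a subsemigroup of the additive semigroup $\mathbb{R}_+=[0,\infty)$ containing $0$, and assume $\mathcal{S}$ is the positive cone of the group $\mathcal{G}$ it generates. Let $T=\{T_s\}_{s\in\mathcal{S}}$ be a Nica-covariant contractive representation of $\mathcal{S}$ on a Hilbert space $\mathcal{H}$. Then $T$ has a minimal isometric dilation which is Nica-covariant. Further, this dilation is unique: if $V$ on $\mathcal{K}_1\supseteq\mathcal{H}$ and $W$ on $\mathcal{K}_2\supseteq\mathcal{H}$ are two minimal isometric Nica-covariant dilations of $T$, then there is a unitary $U:\mathcal{K}_1\to\mathcal{K}_2$ fixing $\mathcal{H}$ pointwise with $UV_s=W_sU$ for all $s\in\mathcal{S}$.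
   Context: Here $\sum^{\oplus}_{i\in I}\mathcal{S}_i$ is the algebraic direct sum (finitely supported families) over an arbitrary index set $I$, with each $\mathcal{S}_i$ regarded as a subsemigroup of $\mathcal{S}$. $\mathcal{G}=\sum^{\oplus}_{i\in I}\mathcal{G}_i$, where $\mathcal{G}_i=\mathcal{S}_i-\mathcal{S}_i\subseteq\mathbb{R}$; that $\mathcal{S}$ is the positive cone of $\mathcal{G}$ means $\mathcal{S}_i=\mathcal{G}_i\cap[0,\infty)$ for every $i$. A contractive (isometric) representation of $\mathcal{S}$ on $\mathcal{H}$ is a family $\{T_s\}_{s\in\mathcal{S}}$ of contractions (isometries) in $\mathcal{B}(\mathcal{H})$ with $T_0=I$ and $T_{s+t}=T_sT_t$ for all $s,t\in\mathcal{S}$. It is Nica-covariant if $T_s^*T_t=T_tT_s^*$ whenever $s\in\mathcal{S}_i$, $t\in\mathcal{S}_j$ with $i\neq j$. An isometric dilation of $T$ is an isometric representation $V=\{V_s\}_{s\in\mathcal{S}}$ on a Hilbert space $\mathcal{K}\supseteq\mathcal{H}$ such that $P_{\mathcal{H}}V_s|_{\mathcal{H}}=T_s$ for all $s\in\mathcal{S}$, where $P_{\mathcal H}$ is the orthogonal projection onto $\mathcal{H}$. It is minimal if $\mathcal{K}=\bigvee_{s\in\mathcal{S}}V_s\mathcal{H}$ (closed linear span). *)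

(* Defs.v *)
From HB Require Import structures.
From mathcomp Require Import all_boot all_order all_algebra.
From mathcomp Require Import all_classical all_reals all_analysis.
From mathcomp Require Import complex.

Set Implicit Arguments.
Unset Strict Implicit.
Unset Printing Implicit Defensive.

Import Order.TTheory GRing.Theory Num.Theory.
Import numFieldNormedType.Exports.

Local Open Scope classical_set_scope.
Local Open Scope ring_scope.

(* Complex Hilbert spaces; the inner product is linear in its first argument
   and conjugate-linear in the second. *)
HB.mixin Record isHilbert (R : realType) (H : Type)
    & CompleteNormedModule R[i] H := {
  inner_form : {dot H for (@Num.conj R[i])} ;
  sqr_normE : forall x : H, `|x| ^+ 2 = inner_form x x
}.

#[short(type="hilbertType")]
HB.structure Definition Hilbert (R : realType) :=
  {H of CompleteNormedModule R[i] H & isHilbert R H}.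

Section Operators.
Context {R : realType}.
Implicit Types H K : hilbertType R.

Definition inner H (x y : H) : R[i] := inner_form x y.

(* The value at [y] of the Hilbert space adjoint of [A], i.e. the vector [z]
   with <A x, y> = <x, z> for all [x]; it exists for every bounded [A]. *)
Definition adjoint H (A : H -> H) (y : H) : H :=
  xget 0 [set z | forall x, inner (A x) y = inner x z].

(* The orthogonal projection of [x] onto [M], i.e. the vector [p] of [M] with
   [x - p] orthogonal to [M]; it exists for every closed subspace [M]. *)
Definition orth_proj H (M : set H) (x : H) : H :=
  xget 0 [set p | M p /\ forall m, M m -> inner (x - p) m = 0].

Definition contractive H (A : H -> H) := forall x, `|A x| <= `|x|.

Definition isometric H K (A : H -> K) := forall x, `|A x| = `|x|.

Definition unitary H K (U : H -> K) :=
  (forall x y, inner (U x) (U y) = inner x y) /\ (forall y, exists x, U x = y).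

Definition linear_span H (A : set H) : set H :=
  [set x | exists n (c : 'I_n -> R[i]) (a : 'I_n -> H),
     (forall k, A (a k)) /\ x = \sum_(k < n) c k *: a k].

End Operators.

Section Semigroups.
Context {R : realType} {I : Type}.
Implicit Type Sg : I -> set R.

Definition subsemigroup (A : set R) :=
  [/\ A `<=` `[0, +oo[, A 0 & forall x y, A x -> A y -> A (x + y)].

Definition generated_group (A : set R) : set R :=
  [set z | exists x y, [/\ A x, A y & z = x - y]].

(* The algebraic direct sum, as a set of families indexed by [I]. *)
Definition direct_sum Sg : set (I -> R) :=
  [set s | (forall i, Sg i (s i)) /\ finite_set [set i | s i != 0]].

(* [direct_sum Sg] is the positive cone of the direct sum of the groups
   generated by the [Sg i]. *)
Definition positive_cone Sg :=
  forall i, Sg i = generated_group (Sg i) `&` `[0, +oo[.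

(* The copy of [A] in the [i]-th summand. *)
Definition summand (i : I) (A : set R) : set (I -> R) :=
  [set s | A (s i) /\ forall j, j <> i -> s j = 0].

End Semigroups.

(* A family of operators indexed by [direct_sum Sg] is a function on all of
   [I -> R] of which only the values on [direct_sum Sg] matter. *)
Section Representations.
Context {R : realType} {I : Type} (Sg : I -> set R).
Implicit Types H K : hilbertType R.

Definition representation H (T : (I -> R) -> {linear H -> H}) :=
  (forall x, T (fun=> 0) x = x) /\
  (forall s t, direct_sum Sg s -> direct_sum Sg t ->
     forall x, T (fun i => s i + t i) x = T s (T t x)).

Definition contractive_rep H (T : (I -> R) -> {linear H -> H}) :=
  representation T /\ forall s, direct_sum Sg s -> contractive (T s).

Definition isometric_rep H (T : (I -> R) -> {linear H -> H}) :=
  representation T /\ forall s, direct_sum Sg s -> isometric (T s).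

Definition Nica_covariant H (T : (I -> R) -> {linear H -> H}) :=
  forall i j, i <> j ->
  forall s t, summand i (Sg i) s -> summand j (Sg j) t ->
  forall x, adjoint (T s) (T t x) = T t (adjoint (T s) x).

(* The inclusion of [H] in [K] is rendered by a linear isometry [J]. *)
Definition isometric_dilation H (T : (I -> R) -> {linear H -> H})
    K (J : {linear H -> K}) (V : (I -> R) -> {linear K -> K}) :=
  [/\ isometric J, isometric_rep V &
      forall s, direct_sum Sg s ->
      forall h, orth_proj (range J) (V s (J h)) = J (T s h)].

Definition minimal_dilation H K (J : {linear H -> K})
    (V : (I -> R) -> {linear K -> K}) :=
  closure (linear_span
    [set V s (J h) | s in direct_sum Sg & h in [set: H]]) = [set: K].

Definition minimal_Nica_dilation H (T : (I -> R) -> {linear H -> H})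
    K (J : {linear H -> K}) (V : (I -> R) -> {linear K -> K}) :=
  [/\ isometric_dilation T J V, minimal_dilation J V & Nica_covariant V].

End Representations.

(* Main.v *)
From HB Require Import structures.
Require Import Defs.
From mathcomp Require Import all_boot all_order all_algebra.
From mathcomp Require Import all_classical all_reals all_analysis.
From mathcomp Require Import complex ring lra.
From mathcomp.multinomials Require Import -(notations) freeg.

(** The proof goes through the kernel
<<
    k((p, h), (q, l)) = < T_((p-q)+) h , T_((q-p)+) l >      (p, q in S),
>>
where [(p-q)+] is the coordinatewise positive part ([pos_diff]), which lies in
[S] because [S] is a positive cone.

Uniqueness.  If [V] is a minimal isometric Nica-covariant dilation, then
minimality gives [V_s^* h = T_s^* h] for [h] in [H] ([dilation_coinvariant]).
With [p = m + (p-q)+] and [q = m + (q-p)+], the isometry [V_m] cancels from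
[< V_p h, V_q l >]; the two positive parts have disjoint supports, so
Nica-covariance of [V] and of [T] identifies what remains with the kernel
([dilation_gram]).  Hence the vectors [V_p h], which are total, have the same
Gram matrix in all such dilations, and a Gram matrix determines a total family
up to a unitary ([total_family_extension]).

Existence.  A positive definite kernel is the Gram matrix of a total family
[Phi p h] in some Hilbert space ([kernel_decomposition]).  The kernel depends on
[p] and [q] only through [p - q], so [Phi p h |-> Phi (s + p) h] extends to an
isometry [V_s]; it compresses to [T_s] because [k((s, h), (0, l)) = < T_s h, l >].
For Nica-covariance it suffices to know [V_s^*] on the vectors [Phi p h] with
[s] in the [i]-th summand: what [p i] covers of [s] is removed by
subtraction, and the rest acts as [T^*] on [h], which does not interfere with
shifts in the other coordinates ([minimal_Nica_dilation_of_kernel]).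

Positive definiteness ([rep_form_ge0]) is the heart of the matter.  Coordinates
are eliminated one by one.  Within the [i]-th coordinate, let [t] be the largest
value taken by the points and [m] the next one; replacing the value [t] by [m]
and the corresponding vectors [h] by [T_(t-m) h] leaves all entries of the form
unchanged except those between points at level [t], and there the form
drops by [Q(h, h) - Q(T_(t-m) h, T_(t-m) h)], where [Q] is the form on the
remaining coordinates, positive by induction.  The operator [T_(t-m)] and its
adjoint commute with everything occurring in [Q], so [C = T_(t-m)^* T_(t-m)] is
symmetric for [Q]; as its powers are bounded, [Q(C h, h) <= Q(h, h)] by a
theorem of Reid ([symmetric_power_bounded_le]).

The Hilbert space theory used on the way (Riesz representation, adjoints,
completions) is built from semi-inner products, i.e. positive semidefinite
hermitian forms on complex vector spaces. *)

Set Implicit Arguments.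
Unset Strict Implicit.
Unset Printing Implicit Defensive.

Import Order.TTheory GRing.Theory Num.Theory.
Import numFieldNormedType.Exports.

Local Open Scope classical_set_scope.
Local Open Scope ring_scope.

Local Notation Re := (@complex.Re _).
Local Notation Im := (@complex.Im _).
Local Notation normc := ComplexField.Normc.normc.
Local Notation normcM := ComplexField.Normc.normcM.
Local Notation eq0_normc := ComplexField.Normc.eq0_normc.

(** * Semi-inner products *)

Section SemiInner.
Context {R : realType} {E : lmodType R[i]}.
Implicit Types (B : E -> E -> R[i]).

Record semi_inner B : Prop := SemiInner {
  semi_linear : forall a x y z, B (a *: x + y) z = a * B x z + B y z;
  semi_conj : forall x y, B y x = conjc (B x y);
  semi_ge0 : forall x, 0 <= B x x }.

Definition snorm B x : R := Num.sqrt (Re (B x x)).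

Context (B : E -> E -> R[i]) (hB : semi_inner B).
Local Notation N := (snorm B).

Lemma semiDl x y z : B (x + y) z = B x z + B y z.
Proof. by rewrite -[x in LHS]scale1r (semi_linear hB) mul1r. Qed.

Lemma semi0l z : B 0 z = 0.
Proof. by apply: (addrI (B 0 z)); rewrite -semiDl !addr0. Qed.

Lemma semiZl a x z : B (a *: x) z = a * B x z.
Proof. by rewrite -[a *: x]addr0 (semi_linear hB) semi0l addr0. Qed.

Lemma semiNl x z : B (- x) z = - B x z.
Proof. by rewrite -scaleN1r semiZl mulN1r. Qed.

Lemma semiBl x y z : B (x - y) z = B x z - B y z.
Proof. by rewrite semiDl semiNl. Qed.

Lemma semiDr x y z : B x (y + z) = B x y + B x z.
Proof.
by rewrite (semi_conj hB) semiDl rmorphD /= -!(semi_conj hB).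
Qed.

Lemma semiNr x z : B x (- z) = - B x z.
Proof. by rewrite (semi_conj hB) semiNl rmorphN /= -(semi_conj hB). Qed.

Lemma semiBr x y z : B x (y - z) = B x y - B x z.
Proof. by rewrite semiDr semiNr. Qed.

Lemma semi0r x : B x 0 = 0.
Proof. by rewrite (semi_conj hB) semi0l conjc0. Qed.

Lemma semiZr a x z : B x (a *: z) = conjc a * B x z.
Proof. by rewrite (semi_conj hB) semiZl rmorphM /= -(semi_conj hB). Qed.

Lemma semi_suml (J : Type) (r : seq J) (P : pred J) (F : J -> E) z :
  B (\sum_(j <- r | P j) F j) z = \sum_(j <- r | P j) B (F j) z.
Proof.
by apply: (big_morph (fun x => B x z)) => [x y|]; rewrite ?semiDl ?semi0l.
Qed.

Lemma semi_sumr (J : Type) (r : seq J) (P : pred J) (F : J -> E) z :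
  B z (\sum_(j <- r | P j) F j) = \sum_(j <- r | P j) B z (F j).
Proof. by apply: big_morph => [x y|]; rewrite ?semiDr ?semi0r. Qed.

Lemma snorm_ge0 x : 0 <= N x. Proof. exact: sqrtr_ge0. Qed.

Lemma semi_diag x : B x x = (N x ^+ 2)%:C%C.
Proof.
have := semi_ge0 hB x; rewrite /snorm; case: (B x x) => a b.
by rewrite lecE /= => /andP[/eqP -> a0]; rewrite sqr_sqrtr.
Qed.

Lemma snorm_sqr x : N x ^+ 2 = Re (B x x).
Proof. by rewrite semi_diag. Qed.

Lemma snorm_eq x y : B x x = B y y -> N x = N y.
Proof. by rewrite /snorm => ->. Qed.

Lemma snorm0 : N 0 = 0.
Proof. by rewrite /snorm semi0l /= sqrtr0. Qed.

Lemma normcJ_sqr (z : R[i]) : z * conjc z = (normc z ^+ 2)%:C%C.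
Proof.
case: z => a b /=; rewrite sqr_sqrtr ?addr_ge0 ?sqr_ge0 //.
by apply/eqP; rewrite eq_complex /=; apply/andP; split; apply/eqP; ring.
Qed.

Lemma normc_ge0 (z : R[i]) : 0 <= normc z.
Proof. by case: z => a b; apply: sqrtr_ge0. Qed.

Lemma snormZ a x : N (a *: x) = normc a * N x.
Proof.
apply/eqP; rewrite -(@eqrXn2 _ 2) ?snorm_ge0 ?mulr_ge0 ?normc_ge0 ?snorm_ge0//.
apply/eqP; apply: complexI; rewrite -semi_diag semiZl semiZr mulrA normcJ_sqr.
by rewrite semi_diag exprMn -rmorphM.
Qed.

Lemma snormN x : N (- x) = N x.
Proof. by apply: snorm_eq; rewrite semiNl semiNr opprK. Qed.

Lemma snormBC x y : N (x - y) = N (y - x).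
Proof. by rewrite -snormN opprB. Qed.

Lemma snormD_sqr x y : N (x + y) ^+ 2 = N x ^+ 2 + 2 * Re (B x y) + N y ^+ 2.
Proof.
rewrite !snorm_sqr semiDl !semiDr [B y x](semi_conj hB).
case: (B x x) => ? ?; case: (B x y) => ? ?; case: (B y y) => ? ? /=; ring.
Qed.

Lemma parallelogram x y :
  N (x + y) ^+ 2 + N (x - y) ^+ 2 = 2 * (N x ^+ 2 + N y ^+ 2).
Proof.
rewrite !snormD_sqr snormN semiNr; case: (B x y) => ? ? /=; ring.
Qed.

(** Either the minimum of the quadratic, at [t = - b / c], is nonnegative, or the
quadratic is affine and hence constant. *)
Lemma sqr_le_of_quadratic (a b c : R) :
  0 <= a -> 0 <= c -> (forall t, 0 <= a + 2 * t * b + t ^+ 2 * c) ->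
  b ^+ 2 <= a * c.
Proof.
move=> a0 c0 h; have [c1|c1] := ltP 0 c.
  have := h (- b / c); rewrite -(pmulr_rge0 _ c1).
  have -> : c * (a + 2 * (- b / c) * b + (- b / c) ^+ 2 * c) = a * c - b ^+ 2.
    by field; rewrite gt_eqF.
  by rewrite subr_ge0.
have c2 : c = 0 by apply/le_anti; rewrite c1 c0.
have [-> |b0] := eqVneq b 0; first by rewrite c2 mulr0 expr0n.
have := h (- (a + 1) / (2 * b)); rewrite c2.
have -> : a + 2 * (- (a + 1) / (2 * b)) * b + (- (a + 1) / (2 * b)) ^+ 2 * 0 = -1.
  by field.
by rewrite oppr_ge0 ler10.
Qed.

Lemma Re_semi_sqr_le x y : Re (B x y) ^+ 2 <= N x ^+ 2 * N y ^+ 2.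
Proof.
apply: sqr_le_of_quadratic; rewrite ?sqr_ge0 // => t.
have := sqr_ge0 (N (x + t%:C%C *: y)); rewrite snormD_sqr semiZr snormZ.
case: (B x y) => a b /=; rewrite expr0n /= addr0 sqrtr_sqr exprMn real_normK ?num_real//.
rewrite oppr0 mul0r subr0; congr (0 <= _); ring.
Qed.

Lemma normc_eq0 (z : R[i]) : (normc z == 0) = (z == 0).
Proof.
apply/eqP/eqP => [|->]; first exact: eq0_normc.
by rewrite /= expr0n /= addr0 sqrtr0.
Qed.

(** The inequality for real parts is applied to [B x y *: y], whose pairing with
[x] is real. *)
Lemma CauchySchwarz_semi x y : normc (B x y) <= N x * N y.
Proof.
rewrite -(@ler_pXn2r _ 2) ?nnegrE ?mulr_ge0 ?snorm_ge0 ?normc_ge0//.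
have [-> |b0] := eqVneq (B x y) 0.
  by rewrite /= expr0n /= addr0 sqrtr0 expr0n /= sqr_ge0.
have b1 : 0 < normc (B x y) ^+ 2.
  by rewrite exprn_gt0 // lt_def normc_ge0 normc_eq0 b0.
have := Re_semi_sqr_le x (B x y *: y).
rewrite semiZr mulrC normcJ_sqr snormZ /= => h.
rewrite -(ler_pM2l b1) -expr2; apply: le_trans h _.
by rewrite le_eqVlt; apply/orP; left; apply/eqP; ring.
Qed.

Lemma Re_le_normc (z : R[i]) : Re z <= normc z.
Proof.
case: z => a b /=; apply: le_trans (ler_norm _) _.
by rewrite -sqrtr_sqr ler_wsqrtr // lerDl sqr_ge0.
Qed.

Lemma Re_semi_le x y : Re (B x y) <= N x * N y.
Proof. exact: le_trans (Re_le_normc _) (CauchySchwarz_semi _ _). Qed.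

Lemma snormD x y : N (x + y) <= N x + N y.
Proof.
rewrite -(@ler_pXn2r _ 2) ?nnegrE ?addr_ge0 ?snorm_ge0//.
by rewrite snormD_sqr; have := Re_semi_le x y; nra.
Qed.

Lemma snorm_dist x y z : N (x - z) <= N (x - y) + N (y - z).
Proof. by rewrite -[x - z](subrKA y) snormD. Qed.

Lemma snormB_ge x y : N x - N y <= N (x - y).
Proof. by rewrite lerBlDr -{1}[x](subrK y) snormD. Qed.

Lemma snorm_dist_dist x y : `|N x - N y| <= N (x - y).
Proof.
by rewrite ler_norml snormB_ge andbT lerNl opprB snormBC snormB_ge.
Qed.

(** Reid's inequality.  If [B (C h) h] exceeded [B h h], Cauchy-Schwarz would
square the excess ratio at each doubling of the exponent, and the powers would
be unbounded.  The bound [M] may come from a norm which is not the one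
of [B]. *)
Lemma symmetric_power_bounded_le (C : E -> E) (h : E) (M : R) :
  (forall x y, B (C x) y = B x (C y)) ->
  (forall n, Re (B (iter n C h) h) <= M) ->
  Re (B (C h) h) <= Re (B h h).
Proof.
move=> symC bM; pose b n := Re (B (iter n C h) h).
have bS n : b (n + n)%N = N (iter n C h) ^+ 2.
  rewrite snorm_sqr /b iterD.
  suff adj x y : B (iter n C x) y = B x (iter n C y) by rewrite adj.
  by elim: n x y => // n IH x y; rewrite iterS symC IH -iterSr.
have bsq n : b n ^+ 2 <= b (n + n)%N * b 0%N.
  by rewrite bS {2}/b /= -snorm_sqr Re_semi_sqr_le.
have b0 : 0 <= b 0%N by rewrite /b /= -snorm_sqr sqr_ge0.
rewrite -/(b 1%N) -/(b 0%N) leNgt; apply/negP => b01.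
have [b00|b0n] := eqVneq (b 0%N) 0.
  by have := bsq 1%N; rewrite b00 mulr0 leNgt exprn_gt0 // -b00.
have b0p : 0 < b 0%N by rewrite lt_def b0n.
pose r := b 1%N / b 0%N.
have r1 : 1 < r by rewrite /r ltr_pdivlMr // mul1r.
have r0 : 0 <= r by apply: le_trans (ltW r1).
have grow k : r ^+ (2 ^ k) * b 0%N <= b (2 ^ k)%N.
  elim: k => [|k IH]; first by rewrite expn0 expr1 /r mulfVK.
  rewrite expnS mul2n -addnn exprD -(ler_pM2r b0p).
  apply: le_trans (bsq (2 ^ k)%N).
  have := mulr_ge0 (exprn_ge0 (2 ^ k) r0) b0; move: IH; nra.
have lin n : 1 + n%:R * (r - 1) <= r ^+ n.
  elim: n => [|n IH]; first by rewrite mul0r addr0 expr0.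
  rewrite exprS; apply: le_trans (ler_wpM2l r0 IH).
  have := sqr_ge0 (r - 1); have : 0 <= n%:R :> R by [].
  rewrite -natr1; nra.
have [n nM] : exists n : nat, M / b 0%N < 1 + n%:R * (r - 1).
  exists (Num.truncn `|M / b 0%N / (r - 1)|).+1.
  have := truncnS_gt `|M / b 0%N / (r - 1)|; set m := _.+1%:R => hm.
  have : M / b 0%N / (r - 1) < m by apply: le_lt_trans (ler_norm _) hm.
  by rewrite ltr_pdivrMr ?subr_gt0 // => h1; apply: lt_trans h1 _; rewrite ltrDr.
have := bM (2 ^ n)%N; rewrite -/(b _) leNgt => /negP; apply.
apply: lt_le_trans (grow n); rewrite -ltr_pdivrMr //; apply: lt_le_trans nM _.
apply: le_trans (lin n) _; apply: ler_weXn2l; first exact: ltW.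
exact: ltnW (ltn_expl _ _).
Qed.

End SemiInner.

(** * Hilbert spaces: completeness, Riesz representation, adjoints *)

Section Harmonic.
Context {R : realType}.

(** The rate at which all sequences below converge: fixing it turns statements
about limits into inequalities with a single constant. *)
Definition harm (n : nat) : R := n.+1%:R^-1.

Lemma harm_gt0 n : 0 < harm n. Proof. by rewrite invr_gt0. Qed.

Lemma harm_ge0 n : 0 <= harm n. Proof. exact: ltW (harm_gt0 n). Qed.

Lemma harm_lt (e : R) : 0 < e ->
  exists n0, forall n, (n0 <= n)%N -> harm n < e.
Proof.
move=> e0; exists (Num.truncn e^-1) => n hn.
rewrite -[e]invrK ltf_pV2 ?posrE ?invr_gt0 //.
by apply: lt_le_trans (truncnS_gt _) _; rewrite ler_nat ltnS.
Qed.

Lemma le_of_harm (a b c : R) : (forall n, a <= b + c * harm n) -> a <= b.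
Proof.
move=> h; apply/ler_addgt0Pr => e e0.
have c0 : 0 < `|c| + 1 by rewrite ltr_pwDr.
have [n0 hn] := harm_lt (divr_gt0 e0 c0).
apply: le_trans (h n0) _; rewrite lerD2l.
apply: le_trans (_ : (`|c| + 1) * harm n0 <= _).
  by rewrite ler_wpM2r ?harm_ge0 // (le_trans (ler_norm _)) // lerDl.
by have := hn n0 (leqnn _); rewrite ltr_pdivlMr // mulrC => /ltW.
Qed.

End Harmonic.

Section HilbertBasics.
Context {R : realType}.
Implicit Types H K : hilbertType R.

Definition hnorm H (x : H) : R := snorm (@inner R H) x.

Lemma inner_semi H : semi_inner (@inner R H).
Proof.
split=> [a x y z|x y|x]; rewrite /inner.
- by rewrite linearDl linearZl_LR.
- by rewrite hermC mul1r.
- exact: dnorm_ge0.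
Qed.

Lemma normE H (x : H) : `|x| = (hnorm x)%:C%C.
Proof.
apply/eqP; rewrite -(@eqrXn2 _ 2) ?lecR ?snorm_ge0 //.
by rewrite sqr_normE -/(inner x x) (semi_diag (inner_semi H)) rmorphXn.
Qed.

Lemma hnorm_le H K (x : H) (y : K) : (`|x| <= `|y|) = (hnorm x <= hnorm y).
Proof. by rewrite !normE lecR. Qed.

Lemma hnorm_eqP H K (x : H) (y : K) : `|x| = `|y| <-> hnorm x = hnorm y.
Proof. by rewrite !normE; split=> [/complexI|->]. Qed.

Lemma hnorm_ge0 H (x : H) : 0 <= hnorm x. Proof. exact: snorm_ge0. Qed.

Lemma hnorm_eq0 H (x : H) : hnorm x = 0 -> x = 0.
Proof. by move=> h; apply/normr0_eq0; rewrite normE h. Qed.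

Lemma hnorm_le0 H (x : H) : hnorm x <= 0 -> x = 0.
Proof. by move=> h; apply: hnorm_eq0; apply/le_anti; rewrite h hnorm_ge0. Qed.

Lemma inner_eq0 H (x : H) : inner x x = 0 -> x = 0.
Proof. by move=> h; apply: hnorm_eq0; rewrite /hnorm /snorm h sqrtr0. Qed.

Lemma inner_ext H (x y : H) : (forall z, inner x z = inner y z) -> x = y.
Proof.
move=> h; apply/eqP; rewrite -subr_eq0; apply/eqP/inner_eq0.
by rewrite (semiBl (inner_semi H)) h subrr.
Qed.

Lemma inner_extr H (x y : H) : (forall z, inner z x = inner z y) -> x = y.
Proof.
move=> h; apply: inner_ext => z.
by rewrite (semi_conj (inner_semi H)) h -(semi_conj (inner_semi H)).
Qed.

Lemma ball_hnorm H (x y : H) (e : R) : ball x e%:C%C y <-> hnorm (x - y) < e.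
Proof. by rewrite -ball_normE /ball_ /= normE ltcR. Qed.

Lemma gt0_complex (e : R[i]) : 0 < e -> exists2 r : R, 0 < r & e = r%:C%C.
Proof.
case: e => a b; rewrite ltcE /= => /andP[/eqP -> a0].
by exists a.
Qed.

Lemma closure_hnorm H (A : set H) (x : H) :
  closure A x <-> forall e, 0 < e -> exists2 y, A y & hnorm (x - y) < e.
Proof.
split=> [cA e e0|h].
  have [|y [Ay /ball_hnorm]] := cA (ball x e%:C%C); last by exists y.
  by apply: nbhsx_ballx; rewrite ltcR.
move=> U /nbhs_ballP[e /= /gt0_complex[r r0 ->] sU].
by have [y Ay yr] := h _ r0; exists y; split=> //; apply/sU/ball_hnorm.
Qed.

(** Passing to the limit in [m], where [d m] tends to zero, leaves [d n] as a
bound for the distance of [u n] to the limit. *)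
Lemma hilbert_complete H (u : nat -> H) (d : nat -> R) :
  (forall e, 0 < e -> exists n0, forall n, (n0 <= n)%N -> d n < e) ->
  (forall m n, hnorm (u m - u n) <= d m + d n) ->
  exists l, forall n, hnorm (u n - l) <= d n.
Proof.
move=> d0 hu.
have /cvg_ex[/= l ul] : cvg (u @ \oo).
  apply: cauchy_cvg; apply: cauchy_exP => _ /gt0_complex[e e0 ->].
  have [n0 hn0] := d0 _ (divr_gt0 e0 (ltr0n _ 2)).
  exists (u n0); exists n0 => //= n /= hn; apply/ball_hnorm.
  apply: le_lt_trans (hu _ _) _; rewrite [ltRHS](splitr e).
  by apply: ltrD; apply: hn0.
exists l => n; apply/ler_addgt0Pr => e e0.
have e2 := divr_gt0 e0 (ltr0n _ 2).
have [n0 hn0] := d0 _ e2.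
have [m /= _ hm] : \forall m \near \oo, ball l (e / 2)%:C%C (u m).
  by apply: ul; apply: nbhsx_ballx; rewrite ltcR.
have := hm (maxn n0 m)%N (leq_maxr _ _); rewrite ball_hnorm => h1.
have h2 := hn0 (maxn n0 m)%N (leq_maxl _ _).
have h3 := hu n (maxn n0 m)%N.
have := snorm_dist (inner_semi H) (u n) (u (maxn n0 m)) l.
rewrite -!/(hnorm _) [hnorm (u (maxn _ _) - l)](snormBC (inner_semi H)).
rewrite -/(hnorm _); lra.
Qed.

Lemma hilbert_harm_complete H (u : nat -> H) :
  (forall m n, hnorm (u m - u n) <= harm m + harm n) ->
  exists l, forall n, hnorm (u n - l) <= harm n.
Proof. by move=> hu; apply: hilbert_complete hu; exact: harm_lt. Qed.

Lemma normcR (r : R) : normc r%:C%C = `|r|.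
Proof. by rewrite /= expr0n /= addr0 sqrtr_sqr. Qed.

(** The representing vector minimises [|x|^2 - 2 Re (f x)].  The parallelogram
law makes minimising sequences Cauchy, and at a point within [harm n ^+ 2 / 2] of
the infimum the first variation bounds the error of the representation
by [harm n]. *)
Lemma Riesz H (f : H -> R[i]) (M : R) :
  (forall a x y, f (a *: x + y) = a * f x + f y) ->
  (forall x, Re (f x) <= M * hnorm x) ->
  exists z, forall x, f x = inner x z.
Proof.
move=> flin fM; have hI := inner_semi H.
have fD x y : f (x + y) = f x + f y by rewrite -[x in LHS]scale1r flin mul1r.
have f0 : f 0 = 0 by apply: (addrI (f 0)); rewrite -fD !addr0.
have fZ a x : f (a *: x) = a * f x by rewrite -[_ *: _]addr0 flin f0 addr0.
pose phi x := hnorm x ^+ 2 - 2 * Re (f x).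
pose A := [set phi x | x in setT].
have philb x : - M ^+ 2 <= phi x.
  rewrite /phi; have := fM x; have := sqr_ge0 (hnorm x - M); nra.
have iA : has_inf A.
  by split; [exists (phi 0), 0 | exists (- M ^+ 2) => _ [x _ <-]].
pose d := inf A.
have dphi x : d <= phi x by apply: ge_inf; [exact: iA.2 | exists x].
have /choice[u hu] : forall n, exists x, phi x < d + harm n ^+ 2 / 2.
  move=> n; have [] := @inf_adherent _ A (harm n ^+ 2 / 2) _ iA.
    by rewrite divr_gt0 // exprn_gt0 // harm_gt0.
  by move=> _ [x _ <-] h; exists x.
have cu m n : hnorm (u m - u n) <= harm m + harm n.
  rewrite -(@ler_pXn2r _ 2) ?nnegrE ?hnorm_ge0 ?addr_ge0 ?harm_ge0 //.
  have := dphi (2^-1%:C%C *: (u m + u n)).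
  rewrite /phi /hnorm (snormZ hI) normcR ger0_norm ?invr_ge0 // exprMn -!/(hnorm _).
  have -> : Re (f (2^-1%:C%C *: (u m + u n))) = 2^-1 * (Re (f (u m)) + Re (f (u n))).
    rewrite fZ fD; case: (f (u m)) => ? ?; case: (f (u n)) => ? ? /=.
    by rewrite mul0r subr0.
  have := parallelogram hI (u m) (u n); rewrite -!/(hnorm _).
  have := hu m; have := hu n; rewrite /phi.
  have : 0 <= harm m * harm n :> R by rewrite mulr_ge0 ?harm_ge0.
  nra.
have [z hz] := hilbert_harm_complete cu.
have Re_eq y : Re (f y) = Re (inner z y).
  have key n : `|Re (inner (u n) y) - Re (f y)| <= harm n * hnorm y.
    rewrite -(@ler_pXn2r _ 2) ?nnegrE ?mulr_ge0 ?hnorm_ge0 ?harm_ge0 //.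
    rewrite real_normK ?num_real // exprMn.
    apply: (@le_trans _ _ (harm n ^+ 2 / 2 * hnorm y ^+ 2)); last first.
      have := sqr_ge0 (hnorm y); have := sqr_ge0 (harm (R := R) n); nra.
    apply: sqr_le_of_quadratic; rewrite ?divr_ge0 ?exprn_ge0 ?harm_ge0 ?hnorm_ge0 // => t.
    have := dphi (u n + t%:C%C *: y); have := hu n; rewrite /phi.
    rewrite /hnorm (snormD_sqr hI) (snormZ hI) normcR exprMn real_normK ?num_real //.
    rewrite (semiZr hI) fD fZ -!/(hnorm _).
    have -> : Re (conjc t%:C%C * inner (u n) y) = t * Re (inner (u n) y).
      by case: (inner _ _) => ? ? /=; rewrite oppr0 mul0r subr0.
    have -> : Re (f (u n) + t%:C%C * f y) = Re (f (u n)) + t * Re (f y).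
      by case: (f (u n)) => ? ?; case: (f y) => ? ? /=; rewrite mul0r subr0.
    move=> h1 h2; have := lt_le_trans h1 (lerD h2 (lexx _)); lra.
  apply/eqP; rewrite -subr_eq0 -normr_eq0 eq_le normr_ge0 andbT.
  apply: (@le_of_harm _ _ _ (2 * hnorm y)) => n; rewrite add0r.
  have h1 := key n.
  have h2 : `|Re (inner (u n - z) y)| <= harm n * hnorm y.
    apply: le_trans (_ : hnorm (u n - z) * hnorm y <= _); last first.
      by rewrite ler_wpM2r ?hnorm_ge0.
    rewrite ler_norml (Re_semi_le hI) andbT lerNl.
    have := Re_semi_le hI (- (u n - z)) y; rewrite (snormN hI) (semiNl hI).
    by case: (inner _ _) => ? ? /=.
  move: h1 h2; rewrite (semiBl hI).
  have -> : Re (inner (u n) y - inner z y) = Re (inner (u n) y) - Re (inner z y).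
    by case: (inner _ _) => ? ?; case: (inner _ _) => ? ?.
  rewrite !ler_norml => /andP[? ?] /andP[? ?]; apply/andP; split; lra.
(* Imaginary parts are real parts at ['i *: x]. *)
exists z => x; have := Re_eq x; have := Re_eq ('i%C *: x).
rewrite [inner x z](semi_conj hI) fZ (semiZr hI).
case: (f x) => a b; case: (inner z x) => a' b' /=.
by move=> h1 h2; congr Complex; lra.
Qed.

(** [adjoint] selects a vector with this property if there is one; by the Riesz
representation there is. *)
Lemma adjointE H (A : {linear H -> H}) : contractive A ->
  forall x y, inner (A x) y = inner x (adjoint A y).
Proof.
move=> cA x y; have hI := inner_semi H.
have [|v|z hz] := @Riesz _ (fun x => inner (A x) y) (hnorm y).
- by move=> a v w; rewrite linearP (semi_linear hI).
- apply: le_trans (Re_semi_le hI _ _) _; rewrite mulrC ler_wpM2l ?hnorm_ge0 //.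
  by rewrite -hnorm_le.
have := @xgetPex _ 0 [set z | forall x, inner (A x) y = inner x z].
by move/(_ (ex_intro _ z hz)); apply.
Qed.

Lemma adjointEr H (A : {linear H -> H}) : contractive A ->
  forall x y, inner x (A y) = inner (adjoint A x) y.
Proof.
move=> cA x y; rewrite (semi_conj (inner_semi H)) adjointE //.
by rewrite -(semi_conj (inner_semi H)).
Qed.

Lemma adjoint_contractive H (A : {linear H -> H}) : contractive A ->
  contractive (adjoint A).
Proof.
move=> cA x; rewrite hnorm_le.
have [-> |x0] := eqVneq (hnorm (adjoint A x)) 0; first exact: hnorm_ge0.
have x1 : 0 < hnorm (adjoint A x) by rewrite lt_def x0 hnorm_ge0.
rewrite -(ler_pM2r x1) -expr2 /hnorm (snorm_sqr (inner_semi H)) -adjointEr //.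
apply: le_trans (Re_semi_le (inner_semi H) _ _) _.
by rewrite ler_wpM2l ?hnorm_ge0 // -!/(hnorm _) -hnorm_le.
Qed.

Lemma adjoint_unique H (A : {linear H -> H}) (y z : H) : contractive A ->
  (forall x, inner (A x) y = inner x z) -> adjoint A y = z.
Proof. by move=> cA h; apply: inner_extr => x; rewrite -adjointE. Qed.

Lemma adjoint_linear H (A : {linear H -> H}) : contractive A ->
  linear (adjoint A).
Proof.
move=> cA a x y; apply: inner_extr => z; have hI := inner_semi H.
by rewrite -adjointE // !(semiDr hI, semiZr hI) !adjointE.
Qed.

Lemma isometric_contractive H (A : {linear H -> H}) :
  isometric A -> contractive A.
Proof. by move=> iA x; rewrite iA. Qed.

Lemma isometric_hnorm H K (A : {linear H -> K}) : isometric A ->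
  forall x, hnorm (A x) = hnorm x.
Proof. by move=> iA x; apply/hnorm_eqP/iA. Qed.

Lemma isometric_inner H K (A : {linear H -> K}) : isometric A ->
  forall x y, inner (A x) (A y) = inner x y.
Proof.
move=> iA; have hH := inner_semi H; have hK := inner_semi K.
have Re_eq x y : Re (inner (A x) (A y)) = Re (inner x y).
  have := snormD_sqr hH x y; have := snormD_sqr hK (A x) (A y).
  by rewrite -linearD -!/(hnorm _) !isometric_hnorm //; lra.
move=> x y; have := Re_eq x y; have := Re_eq x ('i%C *: y).
rewrite linearZ (semiZr hK) (semiZr hH).
case: (inner (A x) _) => a b; case: (inner x y) => a' b' /=.
rewrite !mul0r !mulN1r !sub0r => h1 ->; congr Complex; lra.
Qed.

Lemma inner_eq_isometric H K (A : H -> K) :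
  (forall x, inner (A x) (A x) = inner x x) -> isometric A.
Proof. by move=> h x; apply/hnorm_eqP; rewrite /hnorm /snorm h. Qed.

(** The projection of [y] is [J z], where [z] represents the functional
[x |-> <J x, y>] on [H]. *)
Lemma orth_proj_rangeE H K (J : {linear H -> K}) (y : K) : isometric J ->
  forall h, inner (orth_proj (range J) y) (J h) = inner y (J h).
Proof.
move=> iJ h; have hH := inner_semi H; have hK := inner_semi K.
have [|v|z hz] := @Riesz _ (fun x => inner (J x) y) (hnorm y).
- by move=> a v w; rewrite linearP (semi_linear hK).
- apply: le_trans (Re_semi_le hK _ _) _; rewrite mulrC ler_wpM2l ?hnorm_ge0 //.
  by rewrite -/(hnorm _) isometric_hnorm.
have [] := @xgetPex _ 0 [set p | range J p /\
    forall m, range J m -> inner (y - p) m = 0] _.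
  exists (J z); split=> [|_ [x _ <-]]; first by exists z.
  rewrite (semiBl hK) [inner y _](semi_conj hK) hz -(semi_conj hH).
  by rewrite isometric_inner // subrr.
move=> _ /(_ (J h)); rewrite (semiBl hK) => /(_ (ex_intro2 _ _ h I erefl)).
by move/eqP; rewrite subr_eq0 => /eqP ->.
Qed.

Lemma orth_proj_range H K (J : {linear H -> K}) (y : K) (h : H) : isometric J ->
  (forall k, inner y (J k) = inner h k) -> orth_proj (range J) y = J h.
Proof.
move=> iJ hy; have hK := inner_semi K.
have [|[x _ ex] _] := @xgetPex _ 0 [set p | range J p /\
    forall m, range J m -> inner (y - p) m = 0].
  exists (J h); split=> [|_ [k _ <-]]; first by exists h.
  by rewrite (semiBl hK) hy isometric_inner // subrr.
rewrite /orth_proj -ex; congr (J _); apply: inner_ext => z.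
by rewrite -(isometric_inner iJ) ex orth_proj_rangeE.
Qed.

End HilbertBasics.

(** * Total families and isometric extension *)

Section TotalFamilies.
Context {R : realType}.
Implicit Types H K : hilbertType R.

Definition total_family X K (phi : X -> K) :=
  closure (linear_span (range phi)) = [set: K].

Lemma linear_span_eq X K (K' : lmodType R[i]) (phi : X -> K) (A B : K -> K') :
  linear A -> linear B -> (forall x, A (phi x) = B (phi x)) ->
  forall x, linear_span (range phi) x -> A x = B x.
Proof.
move=> lA lB h _ [n [c [a [ha ->]]]].
pose LA : {linear K -> K'} := HB.pack A (GRing.isLinear.Build _ _ _ _ A lA).
pose LB : {linear K -> K'} := HB.pack B (GRing.isLinear.Build _ _ _ _ B lB).
rewrite -[A]/(LA : K -> K') -[B]/(LB : K -> K') !linear_sum.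
by apply: eq_bigr => k _; rewrite !linearZ /=; have [x _ <-] := ha k; rewrite h.
Qed.

Lemma total_eq X K K' (phi : X -> K) (A B : K -> K') : total_family phi ->
  linear A -> linear B ->
  (forall x, hnorm (A x) <= hnorm x) -> (forall x, hnorm (B x) <= hnorm x) ->
  (forall x, A (phi x) = B (phi x)) -> forall x, A x = B x.
Proof.
move=> tphi lA lB cA cB h x; have hK := inner_semi K'.
have LB (f : K -> K') : linear f -> {morph f : x y / x - y}.
  move=> lf u v; have := lf (-1) v u.
  by rewrite !scaleN1r ![- _ + _]addrC.
apply/eqP; rewrite -subr_eq0; apply/eqP/hnorm_le0.
apply: (@le_of_harm _ _ _ 2) => n; rewrite add0r.
have /closure_hnorm/(_ _ (harm_gt0 n))[y Ay /ltW xy] :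
  closure (linear_span (range phi)) x by rewrite tphi.
have := snorm_dist hK (A x) (A y) (B x); rewrite -!/(hnorm _).
rewrite {2}(linear_span_eq lA lB h Ay) -!LB // [hnorm (B _)](_ : _ = hnorm (B (x - y))).
  by have := cA (x - y); have := cB (x - y); lra.
by rewrite !LB // /hnorm (snormBC hK).
Qed.

Lemma total_inner_eq X K (phi : X -> K) (y z : K) : total_family phi ->
  (forall x, inner y (phi x) = inner z (phi x)) -> y = z.
Proof.
move=> tphi h; have hK := inner_semi K.
apply/eqP; rewrite -subr_eq0; apply/eqP; set w := y - z.
have hw x : inner (phi x) w = 0.
  by rewrite (semi_conj hK) (semiBl hK) h subrr conjc0.
have sw v : linear_span (range phi) v -> inner v w = 0.
  move=> [n [c [a [ha ->]]]]; rewrite (semi_suml hK) big1 // => k _.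
  by have [x _ <-] := ha k; rewrite (semiZl hK) hw mulr0.
apply: hnorm_le0; apply: (@le_of_harm _ _ _ 1) => n; rewrite add0r mul1r.
have /closure_hnorm/(_ _ (harm_gt0 n))[v Av /ltW wv] :
  closure (linear_span (range phi)) w by rewrite tphi.
have [->|w0] := eqVneq (hnorm w) 0; first exact: harm_ge0.
have w1 : 0 < hnorm w by rewrite lt_def w0 hnorm_ge0.
rewrite -(ler_pM2r w1) -expr2 /hnorm (snorm_sqr hK) -[inner w w]subr0 -(sw _ Av).
rewrite -(semiBl hK); apply: le_trans (Re_semi_le hK _ _) _.
by rewrite ler_wpM2r ?hnorm_ge0.
Qed.

(** The graph of the isometry is the closure in [K1 * K2] of the relation
[{(a e, b e)}]: this relation is linear and norm preserving, hence so is its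
closure, which by density and completeness is everywhere defined. *)
Lemma isometric_extension (E : lmodType R[i]) K1 K2
    (a : {linear E -> K1}) (b : {linear E -> K2}) :
  (forall e, hnorm (a e) = hnorm (b e)) -> closure (range a) = setT ->
  exists U : {linear K1 -> K2}, [/\ isometric U, forall e, U (a e) = b e &
    closure (range b) = setT -> forall y, exists x, U x = y].
Proof.
have tot (L1 L2 : hilbertType R) (f : {linear E -> L1}) (g : {linear E -> L2}) :
    (forall e, hnorm (f e) = hnorm (g e)) -> closure (range f) = setT ->
    forall x, exists y, forall n, exists e,
      hnorm (x - f e) <= harm n /\ hnorm (y - g e) <= harm n.
  move=> fg df x; have h1 := inner_semi L1; have h2 := inner_semi L2.
  have /choice[e he] : forall n, exists e, hnorm (x - f e) <= harm n.
    move=> n; have /closure_hnorm/(_ _ (harm_gt0 n))[_ [e _ <-] /ltW] :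
      closure (range f) x by rewrite df.
    by exists e.
  have [|y hy] := @hilbert_harm_complete _ _ (g \o e).
    move=> m n /=; rewrite -linearB -fg linearB.
    apply: le_trans (snorm_dist h1 _ x _) _.
    by rewrite (snormBC h1) lerD // he.
  by exists y => n; exists (e n); rewrite he /hnorm (snormBC h2) hy.
move=> ab da; have h1 := inner_semi K1; have h2 := inner_semi K2.
pose G (x : K1) (y : K2) := forall n, exists e,
  hnorm (x - a e) <= harm n /\ hnorm (y - b e) <= harm n.
have Glin c x y x' y' z : G x y -> G x' y' -> G (c *: x + x') z -> z = c *: y + y'.
  move=> Gx Gx' Gz; apply/eqP; rewrite -subr_eq0; apply/eqP/hnorm_le0.
  apply: (@le_of_harm _ _ _ (2 * (normc c + 2))) => n; rewrite add0r.
  have [e [e1 e2]] := Gx n; have [e' [e'1 e'2]] := Gx' n.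
  have [f [f1 f2]] := Gz n.
  pose w := c *: e + e' - f.
  have aw : hnorm (a w) <= normc c * harm n + harm n + harm n.
    have -> : a w = (- (c *: (x - a e)) - (x' - a e')) + (c *: x + x' - a f).
      have -> : a w = c *: a e + a e' - a f by rewrite /w linearB linearP.
      apply: inner_ext => v.
      by rewrite !(semiBl h1, semiDl h1, semiNl h1, semiZl h1); ring.
    apply: le_trans (snormD h1 _ _) _; apply: lerD; last exact: f1.
    apply: le_trans (snormD h1 _ _) _; rewrite !(snormN h1) (snormZ h1).
    by apply: lerD; rewrite // ler_wpM2l ?normc_ge0.
  have -> : z - (c *: y + y') = (z - b f) - (c *: (y - b e) + (y' - b e')) - b w.
    have -> : b w = c *: b e + b e' - b f by rewrite /w linearB linearP.
    apply: inner_ext => v.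
    by rewrite !(semiBl h2, semiDl h2, semiNl h2, semiZl h2); ring.
  move: aw; rewrite ab => bw.
  apply: le_trans (snormD h2 _ _) _; rewrite (snormN h2) -!/(hnorm _).
  apply: le_trans (_ : (harm n + (normc c * harm n + harm n)) +
    (normc c * harm n + harm n + harm n) <= _); last first.
    by rewrite le_eqVlt; apply/orP; left; apply/eqP; ring.
  apply: lerD bw; apply: le_trans (snormD h2 _ _) _; apply: lerD; first exact: f2.
  rewrite (snormN h2); apply: le_trans (snormD h2 _ _) _; apply: lerD; last exact: e'2.
  by rewrite (snormZ h2) ler_wpM2l ?normc_ge0.
have G0 : G 0 0.
  move=> n; exists 0; rewrite (linear0 a) (linear0 b) !subr0 /hnorm.
  by rewrite !(snorm0 h1, snorm0 h2) harm_ge0.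
have /choice[U hU] : forall x, exists y, G x y by move=> x; exact: tot.
have Ulin : linear U by move=> c x x'; apply: Glin (hU x) (hU x') (hU _).
pose UL : {linear K1 -> K2} := HB.pack U (GRing.isLinear.Build _ _ _ _ U Ulin).
have Guniq x y z : G x y -> G x z -> y = z.
  move=> Gy Gz; have := Glin 0 0 0 x y z G0 Gy.
  by rewrite !scale0r !add0r => /(_ Gz) ->.
have Gab e : G (a e) (b e).
  by move=> n; exists e; rewrite !subrr /hnorm !(snorm0 h1, snorm0 h2) harm_ge0.
exists UL; split.
- move=> x; apply/hnorm_eqP => /=.
  apply/eqP; rewrite -subr_eq0 -normr_eq0 eq_le normr_ge0 andbT.
  apply: (@le_of_harm _ _ _ 2) => n; rewrite add0r.
  have [e [e1 e2]] := hU x n.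
  have := le_trans (snorm_dist_dist h1 _ _) e1.
  have := le_trans (snorm_dist_dist h2 _ _) e2.
  rewrite -!/(hnorm _) ab !ler_norml => /andP[? ?] /andP[? ?].
  apply/andP; split; lra.
- by move=> e; apply: Guniq (hU _) (Gab e).
- move=> db y; have [x hx] := tot _ _ b a (fun e => esym (ab e)) db y.
  exists x; apply: Guniq (hU x) _ => n; have [e [? ?]] := hx n.
  by exists e.
Qed.

(** The universal property turns families of vectors indexed by [X] into linear
maps, to which [isometric_extension] applies. *)
Definition free_space (X : Type) :=
  FreegDefs.type_of (Phant R[i]) (Phant {classic X}).

Definition free_gen X (x : X) : free_space X :=
  Freeg [:: (1, (x : {classic X}))].

Lemma free_space_lift X (V : lmodType R[i]) (phi : X -> V) :
  exists L : {linear free_space X -> V}, forall x, L (free_gen x) = phi x.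
Proof.
pose lift : free_space X -> V := @fglift R[i] V {classic X} phi.
pose A : {additive free_space X -> V} :=
  HB.pack lift (GRing.isZmodMorphism.Build _ _ lift (lift_is_additive _)).
have lin : linear lift.
  move=> c e e'; rewrite -[lift]/(A : _ -> _) raddfD; congr (_ + _).
  have -> : A e = \sum_(x <- dom e) coeff x e *: phi x.
    rewrite -{1}[e]freeg_sumE raddf_sum.
    by apply: eq_bigr => x _; rewrite /= /lift liftU.
  rewrite scaler_sumr -[c *: e]/(fgscale c e) /fgscale raddf_sum.
  by apply: eq_bigr => x _; rewrite /= /lift liftU scalerA.
pose L : {linear free_space X -> V} :=
  HB.pack lift (GRing.isLinear.Build _ _ _ _ lift lin).
by exists L => x; rewrite /= /lift liftU scale1r.
Qed.

Lemma free_space_sum X (e : free_space X) :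
  exists n (c : 'I_n -> R[i]) (x : 'I_n -> X),
    e = \sum_(k < n) c k *: free_gen (x k).
Proof.
exists (size (dom e)), (fun k => coeff (tnth (in_tuple (dom e)) k) e),
  (fun k => tnth (in_tuple (dom e)) k).
rewrite -[LHS]freeg_sumE big_tnth; apply: eq_bigr => k _.
by apply/eqP/freeg_eqP => x; rewrite coeffZ !coeffU mul1r.
Qed.

Lemma range_lift X K (phi : X -> K) (L : {linear free_space X -> K}) :
  (forall x, L (free_gen x) = phi x) -> range L = linear_span (range phi).
Proof.
move=> hL; apply/seteqP; split=> [_ [e _ <-]|_ [n [c [a [ha ->]]]]].
  have [n [c [x ->]]] := free_space_sum e.
  exists n, c, (phi \o x); split=> [k|]; first by exists (x k).
  by rewrite linear_sum; apply: eq_bigr => k _; rewrite linearZ /= hL.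
have /choice[x hx] : forall k, exists x, phi x = a k.
  by move=> k; have [x _ <-] := ha k; exists x.
exists (\sum_(k < n) c k *: free_gen (x k)) => //.
by rewrite linear_sum; apply: eq_bigr => k _; rewrite linearZ /= hL hx.
Qed.

(** The Gram matrix determines the norms of all linear combinations of the
family, so the linear extensions of [phi] and [psi] to the free space have equal
norms. *)
Lemma total_family_extension X K1 K2 (phi : X -> K1) (psi : X -> K2) :
  (forall x y, inner (phi x) (phi y) = inner (psi x) (psi y)) ->
  total_family phi ->
  exists U : {linear K1 -> K2}, [/\ isometric U, forall x, U (phi x) = psi x &
    total_family psi -> forall y, exists x, U x = y].
Proof.
move=> gram tphi; have h1 := inner_semi K1; have h2 := inner_semi K2.
have [a ha] := free_space_lift phi; have [b hb] := free_space_lift psi.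
have [|| U [iU Uab sU]] := @isometric_extension _ _ _ a b.
- move=> e; rewrite /hnorm /snorm; congr (Num.sqrt (Re _)).
  have [n [c [x ->]]] := free_space_sum e.
  rewrite !linear_sum !(semi_suml h1, semi_suml h2); apply: eq_bigr => k _.
  rewrite !(semi_sumr h1, semi_sumr h2); apply: eq_bigr => l _.
  rewrite !linearZ !(semiZl h1, semiZl h2, semiZr h1, semiZr h2) /=.
  by rewrite !ha !hb gram.
- by rewrite (range_lift ha).
exists U; split=> // [x|tpsi]; first by rewrite -ha -hb Uab.
by apply: sU; rewrite (range_lift hb).
Qed.
End TotalFamilies.

(** * Hilbert completion and decomposition of positive definite kernels *)

Section FastLimits.
Context {R : realType}.
Implicit Types (s t : nat -> R[i]) (z w : R[i]).

Lemma harm_le1 n : harm n <= 1 :> R.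
Proof. by rewrite invf_le1 // ler1n. Qed.

Lemma normcJ_real z : normc (conjc z) = normc z.
Proof. by case: z => a b /=; rewrite sqrrN. Qed.

Definition fast_lim s z := exists c : R, forall n, normc (z - s n) <= c * harm n.

Lemma fast_lim_unique s t z w d : fast_lim s z -> fast_lim t w ->
  (forall n, normc (s n - t n) <= d * harm n) -> z = w.
Proof.
move=> [c hc] [c' hc'] hd; apply/eqP; rewrite -subr_eq0 -normc_eq0 eq_le normc_ge0.
rewrite andbT; apply: (@le_of_harm _ _ _ (c + d + c')) => n; rewrite add0r.
have -> : z - w = (z - s n) + (s n - t n) - (w - t n) by ring.
apply: le_trans (le_normcD _ _) _; rewrite normcN; have := le_normcD (z - s n) (s n - t n).
by have := hc n; have := hc' n; have := hd n; lra.
Qed.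

Lemma fast_limP a s t z w : fast_lim s z -> fast_lim t w ->
  fast_lim (fun n => a * s n + t n) (a * z + w).
Proof.
move=> [c hc] [c' hc']; exists (normc a * c + c') => n.
have -> : a * z + w - (a * s n + t n) = a * (z - s n) + (w - t n) by ring.
apply: le_trans (le_normcD _ _) _; rewrite normcM mulrDl -mulrA lerD //.
by rewrite ler_wpM2l ?normc_ge0.
Qed.

Lemma fast_limJ s z : fast_lim s z -> fast_lim (fun n => conjc (s n)) (conjc z).
Proof. by move=> [c hc]; exists c => n; rewrite -rmorphB /= normcJ_real. Qed.

Lemma fast_lim_ge0 s z : fast_lim s z -> (forall n, 0 <= s n) -> 0 <= z.
Proof.
case: z => a b [c hc] s0; rewrite lecE /=.
have h n : (- a <= c * harm n) /\ (`|b| <= c * harm n).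
  have := hc n; have := s0 n; case: (s n) => x y.
  rewrite lecE /= => /andP[/eqP -> x0]; rewrite oppr0 addr0 => hn.
  split; apply: le_trans hn.
    apply: (@le_trans _ _ `|a - x|).
      by rewrite distrC; apply: le_trans (ler_norm _); lra.
    by rewrite -sqrtr_sqr ler_wsqrtr // lerDl sqr_ge0.
  by rewrite -sqrtr_sqr ler_wsqrtr // lerDr sqr_ge0.
apply/andP; split.
  rewrite -normr_eq0 eq_le normr_ge0 andbT.
  by apply: (@le_of_harm _ _ _ c) => n; rewrite add0r; exact: (h n).2.
rewrite -oppr_le0; apply: (@le_of_harm _ _ _ c) => n; rewrite add0r.
exact: (h n).1.
Qed.

(** The limit is the supremum of the lower bounds [t n - c * harm n]. *)
Lemma real_fast_complete (t : nat -> R) (c : R) :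
  (forall m n, `|t m - t n| <= c * (harm m + harm n)) ->
  exists l, forall n, `|l - t n| <= c * harm n.
Proof.
move=> ht; pose A := range (fun n => t n - c * harm n).
have ub n x : A x -> x <= t n + c * harm n.
  by move=> [m _ <-]; have := ht m n; rewrite ler_norml => /andP[_]; lra.
have sA : has_sup A.
  split; first by exists (t 0%N - c * harm 0), 0%N.
  by exists (t 0%N + c * harm 0) => x; exact: ub.
exists (sup A) => n.
have h1 : sup A <= t n + c * harm n by apply: ge_sup (ub n); exact: sA.1.
have h2 : t n - c * harm n <= sup A by apply: ub_le_sup; [exact: sA.2|exists n].
by rewrite ler_norml; apply/andP; split; lra.
Qed.

Lemma complex_fast_complete s (c : R) :
  (forall m n, normc (s m - s n) <= c * (harm m + harm n)) ->
  exists z, forall n, normc (z - s n) <= 2 * c * harm n.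
Proof.
move=> hs.
have hRe (z : R[i]) : `|Re z| <= normc z.
  by case: z => a b /=; rewrite -sqrtr_sqr ler_wsqrtr // lerDl sqr_ge0.
have hIm (z : R[i]) : `|Im z| <= normc z.
  by case: z => a b /=; rewrite -sqrtr_sqr ler_wsqrtr // lerDr sqr_ge0.
have [|a ha] := @real_fast_complete (fun n => Re (s n)) c.
  move=> m n; apply: le_trans (hs m n); apply: le_trans (hRe _).
  by case: (s m) => ? ?; case: (s n).
have [|b hb] := @real_fast_complete (fun n => Im (s n)) c.
  move=> m n; apply: le_trans (hs m n); apply: le_trans (hIm _).
  by case: (s m) => ? ?; case: (s n).
exists (Complex a b) => n; have := ha n; have := hb n.
case: (s n) => x y h1 h2; rewrite /= in h1 h2.
have -> : Complex a b - Complex x y = (a - x)%:C%C + 'i%C * (b - y)%:C%C.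
  by apply/eqP; rewrite eq_complex /=; apply/andP; split; apply/eqP; ring.
apply: le_trans (le_normcD _ _) _; rewrite normcM !normcR.
by rewrite [X in X * _]/= expr0n /= add0r expr1n sqrtr1; lra.
Qed.

End FastLimits.

Section Completion.
Context {R : realType} {E : lmodType R[i]} {B : E -> E -> R[i]}.
Context (hB : semi_inner B).
Local Notation N := (snorm B).
Implicit Types (u v : nat -> E) (f g : E -> R[i]).

(** The functional [f] is the limit of the functionals [B (u n)] in the dual
norm.  The rate [harm] costs no generality, since Cauchy sequences have
subsequences converging at that rate. *)
Definition represents u f := exists c : R,
  forall x n, normc (f x - B (u n) x) <= c * harm n * N x.

Lemma represents_dist u v f : represents u f -> represents v f ->
  exists c : R, 0 <= c /\
    forall m n, N (u m - v n) <= c * (harm m + harm n).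
Proof.
move=> [c hc] [c' hc']; exists (`|c| + `|c'|); split=> [|m n].
  by rewrite addr_ge0.
have [->|w0] := eqVneq (N (u m - v n)) 0.
  by rewrite mulr_ge0 // addr_ge0 ?harm_ge0.
have w1 : 0 < N (u m - v n) by rewrite lt_def w0 snorm_ge0.
rewrite -(ler_pM2r w1) -expr2 (snorm_sqr hB).
apply: le_trans (Re_le_normc _) _; set w := u m - v n.
have -> : B w w = (f w - B (v n) w) - (f w - B (u m) w).
  by rewrite {1}/w (semiBl hB); ring.
apply: le_trans (le_normcD _ _) _; rewrite normcN.
apply: le_trans (lerD (hc' w n) (hc w m)) _; rewrite -mulrDl.
rewrite ler_wpM2r ?snorm_ge0 //.
have : c * harm m <= `|c| * harm m by rewrite ler_wpM2r ?harm_ge0 ?ler_norm.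
have : c' * harm n <= `|c'| * harm n by rewrite ler_wpM2r ?harm_ge0 ?ler_norm.
have : 0 <= `|c| * harm n by rewrite mulr_ge0 ?harm_ge0.
have : 0 <= `|c'| * harm m by rewrite mulr_ge0 ?harm_ge0.
lra.
Qed.

Lemma represents_bounded u f : represents u f ->
  exists c : R, 0 <= c /\ forall n, N (u n) <= c.
Proof.
move=> hu; have [c [c0 hc]] := represents_dist hu hu.
exists (c * 2 + N (u 0%N)); split=> [|n].
  by rewrite addr_ge0 ?snorm_ge0 ?mulr_ge0.
have := snormD hB (u n - u 0%N) (u 0%N); rewrite subrK => h.
apply: le_trans h _; rewrite lerD2r; apply: le_trans (hc _ _) _.
by rewrite ler_wpM2l // -[2]/(1 + 1) lerD // harm_le1.
Qed.

Lemma represents_form u u' v v' f g :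
  represents u f -> represents u' f -> represents v g -> represents v' g ->
  exists d : R, forall m n,
    normc (B (u m) (v m) - B (u' n) (v' n)) <= d * (harm m + harm n).
Proof.
move=> uf u'f vg v'g.
have [c [c0 hc]] := represents_dist uf u'f.
have [d [d0 hd]] := represents_dist vg v'g.
have [a [a0 ha]] := represents_bounded vg.
have [b [b0 hb]] := represents_bounded u'f.
exists (c * a + b * d) => m n.
have -> : B (u m) (v m) - B (u' n) (v' n) =
    B (u m - u' n) (v m) + B (u' n) (v m - v' n).
  by rewrite (semiBl hB) (semiBr hB); ring.
apply: le_trans (le_normcD _ _) _; rewrite mulrDl; apply: lerD.
  apply: le_trans (CauchySchwarz_semi hB _ _) _; rewrite mulrAC.
  by apply: ler_pM => //; exact: snorm_ge0.
apply: le_trans (CauchySchwarz_semi hB _ _) _; rewrite -mulrA.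
by apply: ler_pM => //; exact: snorm_ge0.
Qed.

Definition completion_pred of semi_inner B : {pred E -> R[i]} :=
  fun f => `[< exists u, represents u f >].

Lemma representsP a u v f g : represents u f -> represents v g ->
  represents (fun n => a *: u n + v n) (a *: f + g).
Proof.
move=> [c hc] [d hd]; exists (normc a * c + d) => x n.
rewrite (semi_linear hB).
have -> : (a *: f + g) x - (a * B (u n) x + B (v n) x) =
  a * (f x - B (u n) x) + (g x - B (v n) x).
  by rewrite -[(a *: f + g) x]/(a * f x + g x); ring.
apply: le_trans (le_normcD _ _) _; rewrite normcM !mulrDl; apply: lerD => //.
by rewrite -!mulrA ler_wpM2l ?normc_ge0 // mulrA.
Qed.

Lemma represents_cst x : represents (fun=> x) (B x).
Proof. by exists 0 => y n; rewrite subrr !mul0r normcR normr0. Qed.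

Lemma completion_submod : submod_closed (completion_pred hB).
Proof.
split=> [|a f g /asboolP[u hu] /asboolP[v hv]]; apply/asboolP; last first.
  by exists (fun n => a *: u n + v n); exact: representsP.
exists (fun=> 0); have -> : (0 : E -> R[i]) = B 0.
  by apply/funext => x; rewrite (semi0l hB).
exact: represents_cst.
Qed.

HB.instance Definition _ := GRing.isSubmodClosed.Build R[i] (E -> R[i])
  (completion_pred hB) completion_submod.

(** The completion is realised inside the space of all functions on [E], as the
closure of the functionals [B x] in the dual norm: vectors of seminorm zero are
identified without a quotient, and the vector space structure is
inherited. *)
Record completion := Completion {
  completion_fun :> E -> R[i];
  completion_funP : completion_fun \in completion_pred hB }.

HB.instance Definition _ := [isSub for completion_fun].
HB.instance Definition _ := [Choice of completion by <:].
HB.instance Definition _ := [SubChoice_isSubLmodule of completion by <:].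

Lemma completionP (f : completion) : exists u, represents u f.
Proof. exact/asboolP/completion_funP. Qed.

Definition completion_form (f g : completion) : R[i] :=
  xget 0 [set z | exists u v, [/\ represents u f, represents v g &
    fast_lim (fun n => B (u n) (v n)) z]].

Lemma completion_formP (f g : completion) u v :
  represents u f -> represents v g ->
  fast_lim (fun n => B (u n) (v n)) (completion_form f g).
Proof.
move=> uf vg.
have [d hd] := represents_form uf uf vg vg.
have [z hz] := complex_fast_complete hd.
have : exists z, exists u v, [/\ represents u f, represents v g &
    fast_lim (fun n => B (u n) (v n)) z].
  by exists z, u, v; split=> //; exists (2 * d).
move/(@xgetPex _ 0); rewrite -/(completion_form f g) => -[u' [v' [u'f v'g lim']]].
suff -> : completion_form f g = z by exists (2 * d).
have [d' hd'] := represents_form u'f uf v'g vg.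
apply: (fast_lim_unique lim' (t := fun n => B (u n) (v n)) (d := d' * 2)).
  by exists (2 * d).
by move=> n; apply: le_trans (hd' n n) _; rewrite -mulrA mulr_natl mulr2n.
Qed.

Lemma completion_formE (f g : completion) u v z :
  represents u f -> represents v g -> fast_lim (fun n => B (u n) (v n)) z ->
  completion_form f g = z.
Proof.
move=> uf vg lz; apply: (fast_lim_unique (completion_formP uf vg) lz (d := 0)).
by move=> n; rewrite subrr normcR normr0 mul0r.
Qed.

Lemma completion_form_semi : semi_inner completion_form.
Proof.
split=> [a f g h|f g|f].
- have [u uf] := completionP f; have [v vg] := completionP g.
  have [w wh] := completionP h.
  have r : represents (fun n => a *: u n + v n) (a *: f + g : completion).
    exact: (representsP a uf vg).
  apply: (completion_formE r wh).
  have := fast_limP a (completion_formP uf wh) (completion_formP vg wh).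
  by congr (fast_lim _ _); apply/funext => n; rewrite (semi_linear hB).
- have [u uf] := completionP f; have [v vg] := completionP g.
  apply: (completion_formE vg uf).
  have := fast_limJ (completion_formP uf vg).
  by congr (fast_lim _ _); apply/funext => n; rewrite -(semi_conj hB).
- have [u uf] := completionP f.
  by apply: fast_lim_ge0 (completion_formP uf uf) _ => n; exact: semi_ge0.
Qed.

Lemma completion_embed_subproof x : B x \in completion_pred hB.
Proof. by apply/asboolP; exists (fun=> x); exact: represents_cst. Qed.

Definition completion_embed x : completion :=
  Completion (completion_embed_subproof x).

Lemma completion_embed_linear : linear completion_embed.
Proof.
move=> a x y; apply/val_inj/funext => z /=.
by rewrite (semi_linear hB).
Qed.

Lemma completion_form_embedr (f : completion) x :
  completion_form f (completion_embed x) = f x.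
Proof.
have [u uf] := completionP f.
have rx : represents (fun=> x) (completion_embed x) by exact: represents_cst.
apply: (completion_formE uf rx).
by have [c hc] := uf; exists (c * N x) => n; rewrite mulrAC.
Qed.

Lemma completion_form_embed x y :
  completion_form (completion_embed x) (completion_embed y) = B x y.
Proof. exact: completion_form_embedr. Qed.

Local Notation NK := (snorm completion_form).

Lemma completion_form_eq0 (f : completion) : NK f = 0 -> f = 0.
Proof.
move=> f0; apply/val_inj/funext => x; apply/eqP; rewrite -normc_eq0.
rewrite eq_le normc_ge0 andbT -[val f x](completion_form_embedr f).
apply: le_trans (CauchySchwarz_semi completion_form_semi _ _) _.
by rewrite f0 mul0r.
Qed.

(** Along a sequence [u] representing [f], the value [B (u n) (u n)] tends to the
squared norm of [f] and is close to [f (u n)], which is at most [a * N (u n)].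
Density of [E] and completeness both reduce to this estimate. *)
Lemma completion_norm_le (f : completion) (a : R) : 0 <= a ->
  (forall x, normc (f x) <= a * N x) -> NK f <= a.
Proof.
move=> a0 fa; have [u uf] := completionP f; have [c hc] := uf.
have [d hd] := completion_formP uf uf.
rewrite -(@ler_pXn2r _ 2) ?nnegrE ?snorm_ge0 // (snorm_sqr completion_form_semi).
have Nu n : N (u n) <= a + `|c| * harm n.
  have [->|w0] := eqVneq (N (u n)) 0.
    by rewrite addr_ge0 // mulr_ge0 // harm_ge0.
  have w1 : 0 < N (u n) by rewrite lt_def w0 snorm_ge0.
  rewrite -(ler_pM2r w1) -expr2 (snorm_sqr hB); apply: le_trans (Re_le_normc _) _.
  have -> : B (u n) (u n) = f (u n) - (f (u n) - B (u n) (u n)) by ring.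
  apply: le_trans (le_normcD _ _) _; rewrite normcN mulrDl; apply: lerD => //.
  apply: le_trans (hc _ _) _; rewrite ler_wpM2r ?snorm_ge0 //.
  by rewrite ler_wpM2r ?harm_ge0 ?ler_norm.
apply: (@le_of_harm _ _ _ (2 * a * `|c| + `|c| ^+ 2 + d)) => n.
have -> : completion_form f f =
    (completion_form f f - B (u n) (u n)) + B (u n) (u n) by ring.
have ReD (z w : R[i]) : Re (z + w) = Re z + Re w by case: z; case: w.
rewrite ReD -(snorm_sqr hB); have := Re_le_normc (completion_form f f - B (u n) (u n)).
have := hd n; have := harm_le1 (R := R) n; have := harm_ge0 (R := R) n.
have : N (u n) ^+ 2 <= (a + `|c| * harm n) ^+ 2.
  by rewrite ler_pXn2r ?nnegrE ?snorm_ge0 ?Nu // addr_ge0 // mulr_ge0 ?harm_ge0.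
have := sqr_ge0 `|c|; set C := `|c| ^+ 2 => C0 h1 h2 h3 h4 h5.
have h6 : C * harm n ^+ 2 <= C * harm n.
  by rewrite ler_wpM2l // expr2 ler_piMl.
move: h1 h4 h5 h6; rewrite sqrrD exprMn -/C; lra.
Qed.

Lemma completion_dense (f : completion) u : represents u f ->
  exists c : R, forall n, NK (f - completion_embed (u n)) <= c * harm n.
Proof.
move=> [c hc]; exists `|c| => n; apply: completion_norm_le.
  by rewrite mulr_ge0 // harm_ge0.
move=> x; apply: le_trans (hc x n) _; rewrite ler_wpM2r ?snorm_ge0 //.
by rewrite ler_wpM2r ?harm_ge0 // ler_norm.
Qed.

Lemma completion_near (f : completion) (e : R) : 0 < e ->
  exists x, NK (f - completion_embed x) < e.
Proof.
move=> e0; have [u uf] := completionP f; have [c hc] := completion_dense uf.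
have c0 : 0 < `|c| + 1 by rewrite ltr_pwDr.
have [n0 hn] := harm_lt (divr_gt0 e0 c0).
exists (u n0); apply: le_lt_trans (hc n0) _.
apply: (@le_lt_trans _ _ ((`|c| + 1) * harm n0)).
  by rewrite ler_wpM2r ?harm_ge0 // (le_trans (ler_norm _)) // lerDl.
by have := hn n0 (leqnn _); rewrite ltr_pdivlMr // mulrC.
Qed.

Definition completion_norm (f : completion) : R[i] := (NK f)%:C%C.

Lemma completion_norm_triangle (f g : completion) :
  completion_norm (f + g) <= completion_norm f + completion_norm g.
Proof. by rewrite -rmorphD lecR (snormD completion_form_semi). Qed.

Lemma completion_normZ a (f : completion) :
  completion_norm (a *: f) = `|a| * completion_norm f.
Proof. by rewrite /completion_norm (snormZ completion_form_semi) rmorphM. Qed.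

Lemma completion_norm_eq0 (f : completion) : completion_norm f = 0 -> f = 0.
Proof. by move/complexI; exact: completion_form_eq0. Qed.

HB.instance Definition _ := Lmodule_isNormed.Build R[i] completion
  completion_norm_triangle completion_normZ completion_norm_eq0.

Lemma completion_ball (f g : completion) (e : R) : ball f e%:C%C g <-> NK (f - g) < e.
Proof. by rewrite -ball_normE /ball_ /= -[`|_|]/(completion_norm _) ltcR. Qed.

Lemma completion_complete (F : set_system completion) :
  ProperFilter F -> cauchy F -> cvg F.
Proof.
move=> PF /cauchyP cF; have hK := completion_form_semi.
have /choice[f hf] : forall n, exists f : completion, F (ball f (harm n)%:C%C).
  by move=> n; apply: cF; rewrite ltcR harm_gt0.
have /choice[e he] : forall n, exists x, NK (f n - completion_embed x) < harm n.
  by move=> n; apply: completion_near; exact: harm_gt0.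
have ff m n : NK (f m - f n) <= harm m + harm n.
  have [g [/completion_ball g1 /completion_ball g2]] :=
    filter_ex (filterI (hf m) (hf n)).
  apply: le_trans (snorm_dist hK _ g _) _.
  by rewrite lerD // ?[snorm _ (g - _)](snormBC hK) ltW.
have ee m n : N (e m - e n) <= 2 * (harm m + harm n).
  have -> : N (e m - e n) = NK (completion_embed (e m) - completion_embed (e n)).
    rewrite /snorm; congr (Num.sqrt (Re _)).
    rewrite (semiBl hK) !(semiBr hK) !completion_form_embed.
    by rewrite (semiBl hB) !(semiBr hB).
  apply: le_trans (snorm_dist hK _ (f m) _) _; rewrite (snormBC hK).
  apply: le_trans (lerD (lexx _) (snorm_dist hK _ (f n) _)) _.
  apply: le_trans (lerD (ltW (he m)) (lerD (ff m n) (ltW (he n)))) _; lra.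
(* The points [e n] of [E] follow the filter at distance [2 * harm n], so the
   functionals [B (e n)] converge pointwise; their limit is the limit of [F]. *)
have /choice[g hg] : forall x, exists z : R[i],
    forall n, normc (z - B (e n) x) <= 4 * harm n * N x.
  move=> x; have [|z hz] := @complex_fast_complete _ (fun n => B (e n) x) (2 * N x).
    move=> m n; rewrite -(semiBl hB); apply: le_trans (CauchySchwarz_semi hB _ _) _.
    by rewrite [leRHS]mulrAC ler_wpM2r ?snorm_ge0 ?ee.
  exists z => n; apply: le_trans (hz n) _.
  by rewrite le_eqVlt; apply/orP; left; apply/eqP; ring.
have rg : represents e g by exists 4.
have gK : g \in completion_pred hB by apply/asboolP; exists e.
have [c hc] := @completion_dense (Completion gK) _ rg.
apply/cvg_ex; exists (Completion gK) => U /nbhs_ballP[r /= /gt0_complex[r' r'0 ->] sU].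
have c0 : 0 < `|c| + 2 by rewrite ltr_pwDr.
have [n0 hn] := harm_lt (divr_gt0 r'0 c0).
apply: filterS (hf n0) => h /completion_ball fh; apply/sU/completion_ball.
have := hn n0 (leqnn _); rewrite ltr_pdivlMr // => hr.
apply: le_lt_trans (snorm_dist hK _ (completion_embed (e n0)) _) _.
apply: le_lt_trans (lerD (hc n0) (snorm_dist hK _ (f n0) _)) _.
rewrite [snorm _ (_ - f n0)](snormBC hK).
apply: lt_trans (ler_ltD (lexx _) (ltrD (he n0) fh)) _.
have : c * harm n0 <= `|c| * harm n0 by rewrite ler_wpM2r ?harm_ge0 ?ler_norm.
by move: hr; lra.
Qed.

HB.instance Definition _ := Uniform_isComplete.Build completion completion_complete.

Let zmod_l (g : completion) : zmod_morphism (completion_form ^~ g).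
Proof. by move=> x y; exact: semiBl completion_form_semi _ _ _. Qed.
Let zmod_r (f : completion) : zmod_morphism (completion_form f).
Proof. by move=> x y; exact: semiBr completion_form_semi _ _ _. Qed.
Let scal_l (g : completion) : scalable_for *%R (completion_form ^~ g).
Proof. by move=> a x; exact: semiZl completion_form_semi _ _ _. Qed.
Let scal_r (f : completion) : scalable_for (@Num.conj R[i] \; *%R) (completion_form f).
Proof. by move=> a x; exact: semiZr completion_form_semi _ _ _. Qed.

HB.instance Definition _ := isBilinear.Build R[i] completion completion R[i]
  *%R (@Num.conj R[i] \; *%R) completion_form zmod_l zmod_r scal_l scal_r.

Let herm (f g : completion) : completion_form f g =
  (-1) ^+ false * @Num.conj R[i] (completion_form g f).
Proof. by rewrite mul1r; exact: semi_conj completion_form_semi _ _. Qed.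

HB.instance Definition _ := isHermitianSesquilinear.Build R[i] completion
  false (@Num.conj R[i]) completion_form herm.

Let dot_gt0 (f : completion) : f != 0 -> 0 < completion_form f f.
Proof.
move=> f0; rewrite lt_def semi_ge0 ?andbT; last exact: completion_form_semi.
apply: contra f0 => /eqP h; apply/eqP/completion_form_eq0.
by rewrite /snorm h sqrtr0.
Qed.

HB.instance Definition _ := isDotProduct.Build R[i] completion
  completion_form dot_gt0.

Definition completion_dot : {dot completion for (@Num.conj R[i])} :=
  completion_form.

Let sqr_norm (f : completion) : `|f| ^+ 2 = completion_dot f f.
Proof.
rewrite -[`|f|]/(completion_norm f) -rmorphXn /= [RHS]semi_diag //.
exact: completion_form_semi.
Qed.

HB.instance Definition _ := isHilbert.Build R completion sqr_norm.

End Completion.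

Theorem hilbert_completion (R : realType) (E : lmodType R[i])
    (B : E -> E -> R[i]) : semi_inner B ->
  exists (K : hilbertType R) (a : {linear E -> K}),
    (forall x y, inner (a x) (a y) = B x y) /\ closure (range a) = [set: K].
Proof.
move=> hB.
pose a : {linear E -> completion hB} := HB.pack (completion_embed hB)
  (GRing.isLinear.Build _ _ _ _ (completion_embed hB) (completion_embed_linear hB)).
exists (completion hB : hilbertType R), a; split.
  exact: completion_form_embed.
apply/seteqP; split=> // f _; apply/closure_hnorm => e e0.
by have [x hx] := completion_near f e0; exists (a x); first by exists x.
Qed.

(** Kolmogorov decomposition: the kernel extends to a semi-inner product on the
free space on [X], and the generators are total in its completion. *)
Theorem kernel_decomposition (R : realType) (X : Type) (k : X -> X -> R[i]) :
  (forall x y, k y x = conjc (k x y)) ->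
  (forall n (c : 'I_n -> R[i]) (x : 'I_n -> X),
    0 <= \sum_(i < n) \sum_(j < n) c i * conjc (c j) * k (x i) (x j)) ->
  exists (K : hilbertType R) (phi : X -> K),
    (forall x y, inner (phi x) (phi y) = k x y) /\ total_family phi.
Proof.
move=> kC kge0.
have /choice[L hL] : forall y, exists L : {linear @free_space R X -> R[i]^o},
    forall x, L (free_gen x) = k x y.
  by move=> y; exact: free_space_lift.
have [M hM] : exists M : {linear @free_space R X -> (@free_space R X -> R[i]^o)},
    forall x e, M (free_gen x) e = conjc (L x e).
  have [M hM] := free_space_lift (V := (@free_space R X -> R[i]^o))
    (fun x e => conjc (L x e)).
  by exists M => x e; rewrite hM.
pose B (e f : @free_space R X) : R[i] := M e f.
have Bsum n (c : 'I_n -> R[i]) x m (d : 'I_m -> R[i]) y :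
    B (\sum_(i < n) c i *: free_gen (x i)) (\sum_(j < m) d j *: free_gen (y j))
    = \sum_(i < n) \sum_(j < m) c i * conjc (d j) * k (x i) (y j).
  rewrite /B linear_sum fct_sumE; apply: eq_bigr => i _.
  rewrite linearZ /= -[(_ *: M _) _]/(c i * M _ _) hM linear_sum rmorph_sum mulr_sumr.
  apply: eq_bigr => j _; rewrite linearZ /= hL -[_ *: _]/(_ * _) rmorphM /=.
  by rewrite -kC mulrA.
have hB : semi_inner B.
  split=> [a x y z|x y|x].
  - by rewrite /B linearP.
  - have [n [c [u ->]]] := free_space_sum x; have [m [d [v ->]]] := free_space_sum y.
    rewrite !Bsum exchange_big rmorph_sum; apply: eq_bigr => i _.
    rewrite rmorph_sum; apply: eq_bigr => j _.
    by rewrite /= !rmorphM /= conjcK -kC [d _ * _]mulrC.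
  - by have [n [c [u ->]]] := free_space_sum x; rewrite Bsum.
have [K [a [aB da]]] := hilbert_completion hB.
exists K, (a \o @free_gen R X); split=> [x y|].
  rewrite aB; have := Bsum 1%N (fun=> 1) (fun=> x) 1%N (fun=> 1) (fun=> y).
  by rewrite !big_ord1 !scale1r conjc1 !mul1r.
rewrite /total_family -(range_lift (L := a)) //.
Qed.

(** * Arithmetic of the positive cone *)

Section ConeArithmetic.
Context {R : realType} {I : Type} (Sg : I -> set R).
Hypothesis Sg_semigroup : forall i, subsemigroup (Sg i).
Hypothesis Sg_cone : positive_cone Sg.
Implicit Types (s t p q : I -> R) (i j : I).
Local Notation S := (direct_sum Sg).

Definition upd i (a : R) s : I -> R := fun j => if `[< j = i >] then a else s j.

Definition single i (a : R) : I -> R := upd i a (fun=> 0).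

(** The positive part of [p - q], for which
[p = min p q + pos_diff p q]. *)
Definition pos_diff p q : I -> R := fun i => Num.max (p i - q i) 0.

Lemma upd_same i a s : upd i a s i = a.
Proof. by rewrite /upd asboolT. Qed.

Lemma upd_other i a s j : j <> i -> upd i a s j = s j.
Proof. by move=> ji; rewrite /upd asboolF. Qed.

Lemma eq_at i s t : s i = t i -> (forall j, j <> i -> s j = t j) -> s = t.
Proof.
by move=> ei h; apply/funext => j; have [->|/h] := pselect (j = i).
Qed.

Lemma Sg_ge0 i a : Sg i a -> 0 <= a.
Proof. by have [sub _ _] := Sg_semigroup i => /sub; rewrite /= in_itv /= andbT. Qed.

Lemma Sg0 i : Sg i 0. Proof. by have [] := Sg_semigroup i. Qed.

Lemma SgB i a b : Sg i a -> Sg i b -> b <= a -> Sg i (a - b).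
Proof.
move=> ha hb ba; rewrite Sg_cone; split; first by exists a, b.
by rewrite /= in_itv /= subr_ge0 ba.
Qed.

Lemma direct_sum_ge0 s i : S s -> 0 <= s i.
Proof. by move=> [h _]; exact: Sg_ge0 (h i). Qed.

Lemma direct_sum_supp s : S s ->
  exists l : seq {classic I}, forall i, i \notin l -> s i = 0.
Proof.
move=> [_ /(@finite_seqP {classic I})[l hl]]; exists l => i il.
apply/eqP; apply: contraNT il => si.
by have : [set i | s i != 0] i by []; rewrite hl.
Qed.

Lemma direct_sumI s (l : seq {classic I}) : (forall i, Sg i (s i)) ->
  (forall i, i \notin l -> s i = 0) -> S s.
Proof.
move=> sS sl; split=> //; apply: (@sub_finite_set _ _ [set i | i \in l]).
  move=> i /= si; apply/negPn/negP => /sl si0; by rewrite si0 eqxx in si.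
exact: (@finite_seq {classic I}).
Qed.

Lemma direct_sum0 : S (fun=> 0).
Proof. by apply: (@direct_sumI _ [::]) => // i; exact: Sg0. Qed.

Lemma direct_sumD s t : S s -> S t -> S (s \+ t).
Proof.
move=> sS tS; have [l hl] := direct_sum_supp sS.
have [m hm] := direct_sum_supp tS.
apply: (@direct_sumI _ (l ++ m)) => i.
  by have [_ _ hD] := Sg_semigroup i; apply: hD; [exact: sS.1|exact: tS.1].
by rewrite (@mem_cat {classic I}) negb_or => /andP[il im]; rewrite /= hl // hm // addr0.
Qed.

Lemma direct_sum_pos_diff p q : S p -> S q -> S (pos_diff p q).
Proof.
move=> pS qS; have [l hl] := direct_sum_supp pS.
have [m hm] := direct_sum_supp qS.
apply: (@direct_sumI _ (l ++ m)) => i; rewrite /pos_diff.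
  have [h|h] := leP (p i - q i) 0; first exact: Sg0.
  by apply: SgB; [exact: pS.1|exact: qS.1|rewrite -subr_ge0 ltW].
rewrite (@mem_cat {classic I}) negb_or => /andP[il im].
by rewrite hl // hm // subr0 maxxx.
Qed.

Lemma direct_sum_upd i a s : Sg i a -> S s -> S (upd i a s).
Proof.
move=> ha sS; have [l hl] := direct_sum_supp sS.
apply: (@direct_sumI _ ((i : {classic I}) :: l)) => j.
  have [->|ji] := pselect (j = i); first by rewrite upd_same.
  by rewrite upd_other //; exact: sS.1.
rewrite (@in_cons {classic I}) negb_or => /andP[/eqP ji jl].
by rewrite upd_other // hl.
Qed.

Lemma direct_sum_single i a : Sg i a -> S (single i a).
Proof. by move=> ha; apply: direct_sum_upd => //; exact: direct_sum0. Qed.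

Lemma summand_single i s : summand i (Sg i) s -> s = single i (s i).
Proof.
move=> [_ h]; apply: (@eq_at i); first by rewrite /single upd_same.
by move=> j ji; rewrite /single upd_other // h.
Qed.

Lemma single_summand i a : Sg i a -> summand i (Sg i) (single i a).
Proof.
by move=> ha; split=> [|j ji]; rewrite /single ?upd_same ?upd_other.
Qed.

Lemma single0 i : single i 0 = fun=> 0.
Proof. by apply: (@eq_at i); rewrite /single ?upd_same // => j ji; rewrite upd_other. Qed.

Lemma single_add i (a b : R) : single i (a + b) = single i a \+ single i b.
Proof.
apply: (@eq_at i); rewrite /single /= ?upd_same // => j ji.
by rewrite !upd_other // addr0.
Qed.

Lemma split_coordinate i s : s = single i (s i) \+ upd i 0 s.
Proof.
apply: (@eq_at i); rewrite /single /= ?upd_same ?addr0 // => j ji.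
by rewrite !upd_other // add0r.
Qed.

Lemma direct_sum_ind (P : (I -> R) -> Prop) : P (fun=> 0) ->
  (forall i a s, Sg i a -> S s -> s i = 0 -> P s -> P (single i a \+ s)) ->
  forall s, S s -> P s.
Proof.
move=> P0 PS s sS; have [l] := direct_sum_supp sS.
elim: l s sS => [|i l IH] s sS hl.
  by have -> : s = fun=> 0 by apply/funext => i; exact: hl.
rewrite (split_coordinate i s).
have uS : S (upd i 0 s) by apply: direct_sum_upd => //; exact: Sg0.
apply: PS => //; [exact: sS.1|exact: upd_same|apply: IH => // j jl].
have [->|ji] := pselect (j = i); first by rewrite upd_same.
by rewrite upd_other // hl // (@in_cons {classic I}) negb_or jl andbT; apply/eqP.
Qed.

Lemma pos_diff_shift s p q : pos_diff (s \+ p) (s \+ q) = pos_diff p q.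
Proof. by apply/funext => i; rewrite /pos_diff /= opprD addrACA subrr add0r. Qed.

Lemma pos_diff0r p : S p -> pos_diff p (fun=> 0) = p.
Proof.
by move=> pS; apply/funext => i; rewrite /pos_diff subr0 max_l ?direct_sum_ge0.
Qed.

Lemma pos_diff0l p : S p -> pos_diff (fun=> 0) p = fun=> 0.
Proof.
move=> pS; apply/funext => i; rewrite /pos_diff sub0r max_r //.
by rewrite oppr_le0 direct_sum_ge0.
Qed.

Lemma pos_diff_disjoint p q i : pos_diff p q i = 0 \/ pos_diff q p i = 0.
Proof.
rewrite /pos_diff; have [h|/ltW h] := leP (p i) (q i).
  by left; rewrite max_r // subr_le0.
by right; rewrite max_r // subr_le0.
Qed.

End ConeArithmetic.

(** * Nica-covariant representations and positivity of their kernel *)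

Section NicaRepresentations.
Context {R : realType} {I : Type} (Sg : I -> set R).
Hypothesis Sg_semigroup : forall i, subsemigroup (Sg i).
Hypothesis Sg_cone : positive_cone Sg.
Context (H : hilbertType R) (T : (I -> R) -> {linear H -> H}).
Hypothesis T_rep : contractive_rep Sg T.
Hypothesis T_Nica : Nica_covariant Sg T.
Implicit Types (s t p q : I -> R) (i j : I) (h k x y : H).
Local Notation S := (direct_sum Sg).
Let hH := inner_semi H.

Lemma rep0 x : T (fun=> 0) x = x. Proof. exact: T_rep.1.1. Qed.

Lemma repD s t x : S s -> S t -> T (s \+ t) x = T s (T t x).
Proof. by move=> sS tS; exact: T_rep.1.2. Qed.

Lemma repC s t x : S s -> S t -> T s (T t x) = T t (T s x).
Proof.
move=> sS tS; rewrite -!repD //; congr (T _ x).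
by apply/funext => i; rewrite /= addrC.
Qed.

Lemma rep_contractive s : S s -> contractive (T s).
Proof. exact: T_rep.2. Qed.

Lemma rep_adjointD s t y : S s -> S t ->
  adjoint (T (s \+ t)) y = adjoint (T t) (adjoint (T s) y).
Proof.
move=> sS tS; apply: adjoint_unique => [|x].
  exact/rep_contractive/direct_sumD.
by rewrite repD // !adjointE //; exact: rep_contractive.
Qed.

Lemma Nica_single i a t : Sg i a -> S t -> t i = 0 ->
  forall x, adjoint (T (single i a)) (T t x) = T t (adjoint (T (single i a)) x).
Proof.
move=> ha tS; move: t tS; apply: (direct_sum_ind Sg_semigroup).
  by move=> _ x; rewrite !rep0.
move=> j b t hb tS tj IH ti x.
have bS : S (single j b) by exact: direct_sum_single.
have [ij|ij] := pselect (i = j).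
  have b0 : b = 0 by move: ti; rewrite /= ij tj addr0 /single upd_same.
  have -> : single j b \+ t = t.
    by rewrite b0 single0; apply/funext => l; rewrite /= add0r.
  by apply: IH; rewrite ij tj.
have t0 : t i = 0 by move: ti; rewrite /= /single upd_other // add0r.
by rewrite !repD // (T_Nica ij (single_summand ha) (single_summand hb)) IH.
Qed.

(** Nica-covariance concerns elements of single summands; by induction on the
supports it extends to elements with disjoint supports. *)
Lemma Nica_disjoint s t : S s -> S t -> (forall i, s i = 0 \/ t i = 0) ->
  forall x, adjoint (T s) (T t x) = T t (adjoint (T s) x).
Proof.
move=> sS tS; move: s sS; apply: (direct_sum_ind Sg_semigroup).
  move=> _ x; have c0 := rep_contractive (direct_sum0 Sg_semigroup).
  have a0 y : adjoint (T (fun=> 0)) y = y.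
    by apply: adjoint_unique => // z; rewrite rep0.
  by rewrite !a0.
move=> i a s ha sS si IH dis x.
have aS : S (single i a) by exact: direct_sum_single.
have dis' j : s j = 0 \/ t j = 0.
  have [->|ji] := pselect (j = i); first by left.
  by have := dis j; rewrite /= /single upd_other // add0r.
rewrite !rep_adjointD //.
have [a0|ti] : a = 0 \/ t i = 0.
  by have := dis i; rewrite /= /single upd_same si addr0.
  have aid y : adjoint (T (single i a)) y = y.
    apply: adjoint_unique => [|z]; first exact: rep_contractive.
    by rewrite a0 single0 rep0.
  by rewrite !aid IH.
by rewrite Nica_single // IH.
Qed.

(** The function [g |-> T_(g-)^* T_(g+)] on the group generated by [S], evaluated
at [g = p - q]; without the adjoint the kernel is visibly hermitian. *)
Definition rep_kernel p h q k : R[i] :=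
  inner (T (pos_diff p q) h) (T (pos_diff q p) k).

Lemma rep_kernelC p h q k : rep_kernel q k p h = conjc (rep_kernel p h q k).
Proof. exact: semi_conj. Qed.

Lemma rep_kernel_linear a p h h' q k :
  rep_kernel p (a *: h + h') q k = a * rep_kernel p h q k + rep_kernel p h' q k.
Proof. by rewrite /rep_kernel linearP (semi_linear hH). Qed.

Lemma rep_kernel0l p q k : rep_kernel p 0 q k = 0.
Proof. by rewrite /rep_kernel linear0 (semi0l hH). Qed.

Lemma rep_kernel0r p h q : rep_kernel p h q 0 = 0.
Proof. by rewrite /rep_kernel linear0 (semi0r hH). Qed.

Lemma rep_kernel_bound p h q k : S p -> S q ->
  normc (rep_kernel p h q k) <= hnorm h * hnorm k.
Proof.
move=> pS qS; apply: le_trans (CauchySchwarz_semi hH _ _) _.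
by apply: ler_pM; rewrite ?snorm_ge0 // -!/(hnorm _) -hnorm_le;
   apply: rep_contractive; exact: direct_sum_pos_diff.
Qed.

(** As [p i = q i], the positive parts of [p - q] and [q - p] vanish at [i], so the
adjoint of [T (single i a)] commutes with the operators in the kernel. *)
Lemma rep_kernel_adjoint i a p h q k : Sg i a -> S p -> S q -> p i = q i ->
  rep_kernel p (T (single i a) h) q k =
  rep_kernel p h q (adjoint (T (single i a)) k).
Proof.
move=> ha pS qS pq; have aS : S (single i a) by exact: direct_sum_single.
have pqS := direct_sum_pos_diff Sg_semigroup Sg_cone pS qS.
have qpS := direct_sum_pos_diff Sg_semigroup Sg_cone qS pS.
rewrite /rep_kernel repC // adjointE; last exact: rep_contractive.
by rewrite Nica_single // /pos_diff pq subrr maxxx.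
Qed.

Lemma rep_kernel_adjointl i a p h q k : Sg i a -> S p -> S q -> p i = q i ->
  rep_kernel p (adjoint (T (single i a)) h) q k =
  rep_kernel p h q (T (single i a) k).
Proof.
by move=> ha pS qS pq; rewrite rep_kernelC -rep_kernel_adjoint // -rep_kernelC.
Qed.

(** As long as [m] stays above [q i], the change of [p i] is seen by the positive
part of [p - q] only, which loses [p i - m]. *)
Lemma rep_kernel_lower i m p h q k : S p -> S q -> Sg i m ->
  m <= p i -> q i <= m ->
  rep_kernel p h q k = rep_kernel (upd i m p) (T (single i (p i - m)) h) q k.
Proof.
move=> pS qS hm mp qm.
have dS : S (single i (p i - m)).
  by apply: direct_sum_single => //; exact: SgB (pS.1 i) hm mp.
have uS : S (upd i m p) by exact: direct_sum_upd.
have uqS := direct_sum_pos_diff Sg_semigroup Sg_cone uS qS.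
rewrite /rep_kernel -repD //; congr (inner (T _ _) (T _ _)).
  apply: (@eq_at _ _ i) => [|j ji]; rewrite /= /pos_diff /single ?upd_same.
    by rewrite !max_l ?subr_ge0 ?(le_trans qm) //; ring.
  by rewrite !upd_other // addr0.
apply: (@eq_at _ _ i) => [|j ji]; rewrite /pos_diff ?upd_same ?upd_other //.
by rewrite !max_r // subr_le0 // (le_trans qm).
Qed.

Definition rep_form n (p : 'I_n -> I -> R) (u v : 'I_n -> H) : R[i] :=
  \sum_(a < n) \sum_(b < n) rep_kernel (p a) (u a) (p b) (v b).

Lemma rep_form_semi n (p : 'I_n -> I -> R) :
  (forall u, 0 <= rep_form p u u) -> semi_inner (rep_form p).
Proof.
move=> p0; split=> // [a x y z|x y].
  rewrite /rep_form mulr_sumr -big_split; apply: eq_bigr => b _ /=.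
  rewrite mulr_sumr -big_split; apply: eq_bigr => c _ /=.
  exact: rep_kernel_linear.
rewrite /rep_form exchange_big rmorph_sum; apply: eq_bigr => b _ /=.
by rewrite rmorph_sum; apply: eq_bigr => c _; exact: rep_kernelC.
Qed.

(** The [i]-th operator and its adjoint move across the form at points with equal
[i]-th coordinates, so [C = A^* A] is symmetric for the form, while its powers are
bounded in the norm of [H].  Reid's inequality for [C] is the claim. *)
Lemma rep_form_contractive n (p : 'I_n -> I -> R) i a (u : 'I_n -> H) :
  (forall u, 0 <= rep_form p u u) ->
  Sg i a -> (forall b, S (p b)) -> (forall b c, p b i = p c i) ->
  rep_form p (fun b => T (single i a) (u b)) (fun b => T (single i a) (u b)) <=
  rep_form p u u.
Proof.
move=> p0 ha pS pi; have hB := rep_form_semi p0.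
have cA : contractive (T (single i a)) by apply: rep_contractive; exact: direct_sum_single.
pose A (v : 'I_n -> H) := fun b => T (single i a) (v b).
pose C (v : 'I_n -> H) := fun b => adjoint (T (single i a)) (A v b).
have CA v w : rep_form p (C v) w = rep_form p (A v) (A w).
  apply: eq_bigr => b _; apply: eq_bigr => c _.
  by rewrite rep_kernel_adjointl.
have AC v w : rep_form p v (C w) = rep_form p (A v) (A w).
  apply: eq_bigr => b _; apply: eq_bigr => c _.
  by rewrite rep_kernel_adjoint.
have itC m b : hnorm (iter m C u b) <= hnorm (u b).
  elim: m => // m IH; rewrite iterS; apply: le_trans IH; rewrite -hnorm_le.
  exact: le_trans (adjoint_contractive cA _) (cA _).
suff : Re (rep_form p (C u) u) <= Re (rep_form p u u).
  by rewrite CA -!(snorm_sqr hB) -[A u]/(fun b => _) !(semi_diag hB) lecR.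
apply: (@symmetric_power_bounded_le _ _ _ hB C u
  (\sum_(b < n) \sum_(c < n) hnorm (u b) * hnorm (u c))) => [v w|m].
  by rewrite CA AC.
have -> : Re (rep_form p (iter m C u) u) = \sum_(b < n) \sum_(c < n)
    Re (rep_kernel (p b) (iter m C u b) (p c) (u c)).
  have Re_sum (F : 'I_n -> R[i]) : Re (\sum_(b < n) F b) = \sum_(b < n) Re (F b).
    by apply: big_morph => // -[? ?] [? ?].
  by rewrite Re_sum; apply: eq_bigr => b _; exact: Re_sum.
apply: ler_sum => b _; apply: ler_sum => c _.
apply: le_trans (Re_le_normc _) _; apply: le_trans (rep_kernel_bound _ _ _ _) _ => //.
by rewrite ler_wpM2r ?hnorm_ge0.
Qed.

(** Coordinates are removed one at a time, and within a coordinate the largest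
value [t] is merged into the next one [m].  This changes the form by the defect of
the operator of [t - m], nonnegative by [rep_form_contractive]. *)
Lemma rep_form_ge0 n (p : 'I_n -> I -> R) (h : 'I_n -> H) :
  (forall a, S (p a)) -> 0 <= rep_form p h h.
Proof.
move=> pS.
have [l hl] : exists l : seq {classic I}, forall a i, i \notin l -> p a i = 0.
  have /choice[L hL] : forall a, exists l : seq {classic I},
      forall i, i \notin l -> p a i = 0 by move=> a; exact: direct_sum_supp (pS a).
  exists (flatten [seq L a | a <- enum 'I_n]) => a i /flattenP il.
  apply: hL; apply/negP => iL; apply: il; exists (L a) => //.
  by apply: map_f; rewrite mem_enum.
elim: l p h pS hl => [|i l IHl] p h pS hl.
  have p0 a : p a = fun=> 0 by apply/funext => i; exact: hl.
  have -> : rep_form p h h = inner (\sum_(a < n) h a) (\sum_(a < n) h a).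
    rewrite (semi_suml hH); apply: eq_bigr => a _.
    rewrite (semi_sumr hH); apply: eq_bigr => b _.
    by rewrite /rep_kernel !p0 (pos_diff0r Sg_semigroup) ?rep0 //; exact: direct_sum0.
  exact: semi_ge0.
have flat (q : 'I_n -> I -> R) (v : 'I_n -> H) : (forall a, S (q a)) ->
    (forall a j, j \notin i :: l -> q a j = 0) ->
    0 <= rep_form (fun a => upd i 0 (q a)) v v.
  move=> qS ql; apply: IHl => a; first by apply: direct_sum_upd => //; exact: Sg0.
  move=> j jl; have [->|ji] := pselect (j = i); first by rewrite upd_same.
  by rewrite upd_other // ql // (@in_cons {classic I}) negb_or jl andbT; apply/eqP.
(* The values at [i] in decreasing order; repetitions do no harm, as they only
   produce steps with [t = m]. *)
have [c [cs cS cp]] : exists c : seq R, [/\ sorted >=%R c,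
    forall r, r \in c -> Sg i r & forall a, p a i \in c].
  exists (sort >=%R [seq p a i | a <- enum 'I_n]); split.
  - by apply: sort_sorted => x y; exact: le_total.
  - by move=> r; rewrite mem_sort => /mapP[a _ ->]; exact: (pS a).1.
  - by move=> a; rewrite mem_sort; apply: map_f; rewrite mem_enum.
elim: c cs cS p h pS hl cp => [|t [|m c] IHc] cs cS p h pS hl cp.
- by rewrite /rep_form big1 // => a; have := cp a.
- have -> : rep_form p h h = rep_form (fun a => upd i 0 (p a)) h h.
    have pt a : p a i = t by have := cp a; rewrite inE => /eqP.
    have E a b : pos_diff (p a) (p b) = pos_diff (upd i 0 (p a)) (upd i 0 (p b)).
      apply: (@eq_at _ _ i) => [|j ji]; rewrite /pos_diff.
        by rewrite !upd_same !pt !subrr.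
      by rewrite !upd_other.
    apply: eq_bigr => a _; apply: eq_bigr => b _.
    by rewrite /rep_kernel E [pos_diff (p b) _]E.
  exact: flat.
have mS : Sg i m by apply: cS; rewrite !inE eqxx orbT.
have tS : Sg i t by apply: cS; rewrite inE eqxx.
have /andP[mt cs'] : (m <= t) && path >=%R m c := cs.
have cm r : r \in m :: c -> r <= m.
  have tr : transitive (>=%R : rel R) by move=> y x z /= yx zy; exact: le_trans zy yx.
  have /allP h0 := order_path_min tr cs'.
  by rewrite inE => /predU1P[->//|/h0].
have dS : Sg i (t - m) by exact: SgB.
pose top a := p a i == t.
pose D := T (single i (t - m)).
pose p' a := if top a then upd i m (p a) else p a.
pose h' a := if top a then D (h a) else h a.
pose p0 a := upd i 0 (p a).
pose u a := if top a then h a else 0.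
have p'S a : S (p' a) by rewrite /p'; case: ifP => // _; exact: direct_sum_upd.
have low a : top a = false -> p a i <= m.
  move=> ta; apply: cm; have := cp a; rewrite inE => /predU1P[pt|//].
  by rewrite /top pt eqxx in ta.
(* Off the block of points at level [t] this is [rep_kernel_lower]; within it
   only the coordinates other than [i] contribute. *)
have -> : rep_form p h h = rep_form p' h' h' +
    (rep_form p0 u u - rep_form p0 (fun a => D (u a)) (fun a => D (u a))).
  rewrite /rep_form -sumrB -big_split; apply: eq_bigr => a _ /=.
  rewrite -sumrB -big_split; apply: eq_bigr => b _ /=.
  rewrite /p' /h' /u.
  case: ifPn => [/eqP ta|/negbTE ta]; case: ifPn => [/eqP tb|/negbTE tb].
  - have E : pos_diff (p a) (p b) = pos_diff (p0 a) (p0 b) /\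
      pos_diff (p b) (p a) = pos_diff (p0 b) (p0 a) by split;
      apply: (@eq_at _ _ i) => [|j ji]; rewrite /pos_diff /p0 ?upd_same ?ta ?tb ?subrr ?upd_other.
    have E' : pos_diff (upd i m (p a)) (upd i m (p b)) = pos_diff (p0 a) (p0 b) /\
      pos_diff (upd i m (p b)) (upd i m (p a)) = pos_diff (p0 b) (p0 a) by split;
      apply: (@eq_at _ _ i) => [|j ji]; rewrite /pos_diff /p0 ?upd_same ?subrr ?upd_other.
    rewrite /rep_kernel E.1 E.2 E'.1 E'.2; ring.
  - rewrite !linear0 !rep_kernel0r subrr addr0 (rep_kernel_lower _ _ _ _ mS) ?ta //.
    exact: low.
  - rewrite !linear0 !rep_kernel0l subrr addr0 rep_kernelC [RHS]rep_kernelC.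
    by rewrite (rep_kernel_lower _ _ _ _ mS) ?tb // low.
  - by rewrite !linear0 !rep_kernel0l subrr addr0.
apply: addr_ge0.
  apply: IHc => //.
  - by move=> r rc; apply: cS; rewrite in_cons rc orbT.
  - move=> a j jl; rewrite /p'; case: ifP => _; last exact: hl.
    rewrite upd_other ?hl // => ji; move: jl.
    by rewrite (@in_cons {classic I}) negb_or => /andP[/eqP].
  - move=> a; rewrite /p'; case: ifPn => [_|ta]; first by rewrite upd_same mem_head.
    by have := cp a; rewrite inE => /predU1P[pt|//]; rewrite /top pt eqxx in ta.
rewrite subr_ge0; apply: rep_form_contractive => //.
- by move=> v; exact: flat.
- by move=> b; apply: direct_sum_upd => //; exact: Sg0.
- by move=> b d; rewrite /p0 !upd_same.
Qed.

End NicaRepresentations.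

(** * The minimal Nica-covariant isometric dilation *)

Section MinimalNicaDilation.
Context {R : realType} {I : Type} (Sg : I -> set R).
Hypothesis Sg_semigroup : forall i, subsemigroup (Sg i).
Hypothesis Sg_cone : positive_cone Sg.
Context (H : hilbertType R) (T : (I -> R) -> {linear H -> H}).
Hypothesis T_rep : contractive_rep Sg T.
Hypothesis T_Nica : Nica_covariant Sg T.
Implicit Types (s t p q r : I -> R) (i j : I) (h k : H).
Local Notation S := (direct_sum Sg).
Let hH := inner_semi H.

Lemma pos_diff_split p q : S p -> S q ->
  exists m, [/\ S m, p = m \+ pos_diff p q & q = m \+ pos_diff q p].
Proof.
move=> pS qS; have [l hl] := direct_sum_supp pS.
have [l' hl'] := direct_sum_supp qS.
exists (fun i => Num.min (p i) (q i)); split.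
- apply: (@direct_sumI _ _ _ _ (l ++ l')) => i.
    by rewrite /Num.min; case: ifP => _; [exact: pS.1|exact: qS.1].
  rewrite (@mem_cat {classic I}) negb_or => /andP[il il'].
  by rewrite hl // hl' // minxx.
- apply/funext => i; rewrite /pos_diff /=.
  by case: (leP (p i) (q i)); case: (leP (p i - q i) 0); lra.
- apply/funext => i; rewrite /pos_diff /=.
  by case: (leP (p i) (q i)); case: (leP (q i - p i) 0); lra.
Qed.

Definition dilation_family K (J : H -> K) (V : (I -> R) -> K -> K)
  (x : {s | S s} * H) : K := V (sval x.1) (J x.2).

Section Uniqueness.
Context (K : hilbertType R) (J : {linear H -> K})
  (V : (I -> R) -> {linear K -> K}).
Hypothesis V_dil : minimal_Nica_dilation Sg T J V.
Let hK := inner_semi K.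

Lemma dilation_isometric s : S s -> isometric (V s).
Proof. by have [[_ [_ h] _] _ _] := V_dil; exact: h. Qed.

Lemma dilation_contractive_rep : contractive_rep Sg V.
Proof.
have [[_ [h _] _] _ _] := V_dil; split=> // s sS.
exact/isometric_contractive/dilation_isometric.
Qed.

Lemma dilation_compression s h k : S s ->
  inner (V s (J h)) (J k) = inner (T s h) k.
Proof.
move=> sS; have [[iJ _ dil] _ _] := V_dil.
by rewrite -orth_proj_rangeE // dil // isometric_inner.
Qed.

Lemma dilation_total : total_family (dilation_family J V).
Proof.
have [_ mV _] := V_dil; rewrite /total_family -mV; congr (closure (linear_span _)).
apply/seteqP; split=> [_ [[[s sS] h] _ <-]|_ [s sS [h _ <-]]].
  by exists s => //; exists h.
by exists (exist _ s sS, h).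
Qed.

(** Paired with a vector [V r (J k)] of the total family, both sides give
[<h, T (s + r) k>], because the compression of [V (s + r)] to [H] is
[T (s + r)]. *)
Lemma dilation_coinvariant s h : S s ->
  adjoint (V s) (J h) = J (adjoint (T s) h).
Proof.
move=> sS; have hV := dilation_contractive_rep.
apply: (total_inner_eq dilation_total) => -[[r rS] k] /=.
have dil t h' k' : S t -> inner (J h') (V t (J k')) = inner h' (T t k').
  move=> tS; rewrite (semi_conj hK) dilation_compression //.
  by rewrite -(semi_conj hH).
rewrite /dilation_family /= -adjointEr; last exact: rep_contractive hV _ sS.
rewrite -(repD hV) // !dil //; last exact: direct_sumD.
by rewrite (repD T_rep) // adjointEr //; exact: rep_contractive T_rep _ sS.
Qed.

(** After cancelling the common part [m] of [p] and [q], Nica-covariance of [V]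
moves the adjoint of [V (pos_diff q p)] onto [J h], where it is the adjoint of
[T (pos_diff q p)]; Nica-covariance of [T] moves it back. *)
Lemma dilation_gram p h q k : S p -> S q ->
  inner (V p (J h)) (V q (J k)) = rep_kernel T p h q k.
Proof.
move=> pS qS; have hV := dilation_contractive_rep.
have [_ _ V_Nica] := V_dil.
have [m [mS pE qE]] := pos_diff_split pS qS.
have aS := direct_sum_pos_diff Sg_semigroup Sg_cone pS qS.
have bS := direct_sum_pos_diff Sg_semigroup Sg_cone qS pS.
have dis j : pos_diff q p j = 0 \/ pos_diff p q j = 0 by exact: pos_diff_disjoint.
have -> : inner (V p (J h)) (V q (J k)) =
    inner (V m (V (pos_diff p q) (J h))) (V m (V (pos_diff q p) (J k))).
  by rewrite -!(repD hV) // -pE -qE.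
rewrite isometric_inner; last exact: dilation_isometric.
rewrite adjointEr; last exact: rep_contractive hV _ bS.
rewrite (Nica_disjoint Sg_semigroup hV V_Nica) // dilation_coinvariant //.
rewrite dilation_compression // -(Nica_disjoint Sg_semigroup T_rep T_Nica) //.
by rewrite -adjointEr //; exact: rep_contractive T_rep _ bS.
Qed.

End Uniqueness.

Lemma minimal_Nica_dilation_unique (K1 K2 : hilbertType R)
    (J1 : {linear H -> K1}) (J2 : {linear H -> K2})
    (V : (I -> R) -> {linear K1 -> K1}) (W : (I -> R) -> {linear K2 -> K2}) :
  minimal_Nica_dilation Sg T J1 V -> minimal_Nica_dilation Sg T J2 W ->
  exists U : {linear K1 -> K2},
    [/\ unitary U, forall h, U (J1 h) = J2 h &
        forall s, S s -> forall x, U (V s x) = W s (U x)].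
Proof.
move=> dV dW.
have [|| U [iU UVW sU]] := @total_family_extension _ _ _ _
    (dilation_family J1 V) (dilation_family J2 W).
- move=> [[p pS] h] [[q qS] k]; rewrite /dilation_family /=.
  by rewrite (dilation_gram dV) // (dilation_gram dW).
- exact: dilation_total dV.
have hV := dilation_contractive_rep dV; have hW := dilation_contractive_rep dW.
have UVJ s h : S s -> U (V s (J1 h)) = W s (J2 h).
  by move=> sS; exact: (UVW (exist _ s sS, h)).
exists U; split.
- split; first exact: isometric_inner.
  exact: sU (dilation_total dW).
- move=> h; rewrite -[J1 h](rep0 hV) -[RHS](rep0 hW).
  by rewrite UVJ //; exact: direct_sum0.
move=> s sS x.
have iV := isometric_hnorm (dilation_isometric dV sS).
have iW := isometric_hnorm (dilation_isometric dW sS).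
apply: (total_eq (dilation_total dV) (A := U \o V s) (B := W s \o U)) => [a y z|a y z|y|y|].
- by rewrite /= !linearP.
- by rewrite /= !linearP.
- by rewrite /= isometric_hnorm // iV.
- by rewrite /= iW isometric_hnorm.
move=> [[p pS] h]; rewrite /dilation_family /=.
rewrite -(repD hV) // !UVJ //; last exact: direct_sumD.
by rewrite (repD hW).
Qed.

Section Existence.
Context (K : hilbertType R) (Phi : (I -> R) -> H -> K).
Hypothesis Phi_gram : forall p h q k, S p -> S q ->
  inner (Phi p h) (Phi q k) = rep_kernel T p h q k.
Local Notation phi := (fun x : {s | S s} * H => Phi (sval x.1) x.2).
Hypothesis Phi_total : total_family phi.
Let hK := inner_semi K.
Let S0 : S (fun=> 0) := direct_sum0 Sg_semigroup.

Lemma Phi_inner_eq (y z : K) :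
  (forall p h, S p -> inner y (Phi p h) = inner z (Phi p h)) -> y = z.
Proof.
by move=> h; apply: (total_inner_eq Phi_total) => -[[p pS] k]; exact: h.
Qed.

Lemma Phi_linear p : S p -> linear (Phi p).
Proof.
move=> pS a h h'; apply: Phi_inner_eq => q k qS.
by rewrite (semi_linear hK) !Phi_gram // rep_kernel_linear.
Qed.

Lemma Phi_shift s : exists V : {linear K -> K}, S s ->
  isometric V /\ forall p h, S p -> V (Phi p h) = Phi (s \+ p) h.
Proof.
have [sS|] := pselect (S s); last by exists idfun.
have [||V [iV hV _]] := @total_family_extension _ _ _ _ phi
    (fun x : {s | S s} * H => Phi (s \+ sval x.1) x.2).
- move=> [[p pS] h] [[q qS] k] /=; rewrite !Phi_gram //; try exact: direct_sumD.
  by rewrite /rep_kernel !pos_diff_shift.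
- exact: Phi_total.
by exists V => _; split=> // p h pS; exact: (hV (exist _ p pS, h)).
Qed.

(** The dilation consists of the shifts [Phi p h |-> Phi (s + p) h], with [H]
embedded as [Phi 0]. *)
Lemma minimal_Nica_dilation_of_kernel :
  exists (J : {linear H -> K}) (V : (I -> R) -> {linear K -> K}),
    minimal_Nica_dilation Sg T J V.
Proof.
have [V hV] := choice Phi_shift.
have VI s : S s -> isometric (V s) by move=> /hV[].
have VE s p h : S s -> S p -> V s (Phi p h) = Phi (s \+ p) h.
  by move=> /hV[_ h'] /h'.
have VC s : S s -> contractive (V s) by move=> /VI; exact: isometric_contractive.
have VN s : S s -> forall x, hnorm (V s x) = hnorm x.
  by move=> /VI; exact: isometric_hnorm.
have Phi_eq (A B : K -> K) : linear A -> linear B ->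
    (forall x, hnorm (A x) <= hnorm x) -> (forall x, hnorm (B x) <= hnorm x) ->
    (forall p h, S p -> A (Phi p h) = B (Phi p h)) -> forall x, A x = B x.
  move=> lA lB cA cB AB; apply: (total_eq Phi_total) => // -[[p pS] h].
  exact: AB.
pose J : {linear H -> K} :=
  HB.pack (Phi (fun=> 0)) (GRing.isLinear.Build _ _ _ _ (Phi (fun=> 0)) (Phi_linear S0)).
have add0 s : s \+ (fun=> 0) = s by apply/funext => i; rewrite /= addr0.
have VJ s h : S s -> V s (J h) = Phi s h by move=> sS; rewrite /= VE // add0.
have V_rep : isometric_rep Sg V.
  split=> //; split.
    apply: Phi_eq => [a x y|a x y|x|x|p h pS]; rewrite ?linearP ?VN //.
    by rewrite VE //; congr (Phi _ h); apply/funext => i; rewrite /= add0r.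
  move=> s t sS tS; have stS := direct_sumD Sg_semigroup sS tS.
  apply: (Phi_eq _ (V s \o V t)) => [a x y|a x y|x|x|p h pS] /=.
  - by rewrite linearP.
  - by rewrite !linearP.
  - by rewrite VN.
  - by rewrite !VN.
  rewrite !VE //; last exact: direct_sumD.
  by congr (Phi _ h); apply/funext => i; rewrite /= addrA.
have V_crep : contractive_rep Sg V by split; [exact: V_rep.1|exact: VC].
(* As [p i = 0], the kernel sees the shift of [q] by [single i b] only as the
   operator [T (single i b)] in its second argument. *)
have Vadj i b p h : Sg i b -> S p -> p i = 0 ->
    adjoint (V (single i b)) (Phi p h) = Phi p (adjoint (T (single i b)) h).
  move=> hb pS pi; have bS := direct_sum_single Sg_semigroup hb.
  apply: Phi_inner_eq => q k qS.
  rewrite -adjointEr ?VE //; last exact: VC.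
  have bqS := direct_sumD Sg_semigroup bS qS.
  have qpS := direct_sum_pos_diff Sg_semigroup Sg_cone qS pS.
  have pqS := direct_sum_pos_diff Sg_semigroup Sg_cone pS qS.
  have q0 := direct_sum_ge0 Sg_semigroup i qS.
  have b0 := Sg_ge0 Sg_semigroup hb.
  have pq0 : pos_diff p q i = 0 by rewrite /pos_diff pi max_r //; lra.
  rewrite !Phi_gram // /rep_kernel.
  have -> : pos_diff p (single i b \+ q) = pos_diff p q.
    apply: (@eq_at _ _ i) => [|j ji]; rewrite /pos_diff /single /=.
      by rewrite upd_same pi !max_r //; lra.
    by rewrite upd_other // add0r.
  have -> : pos_diff (single i b \+ q) p = single i b \+ pos_diff q p.
    apply: (@eq_at _ _ i) => [|j ji]; rewrite /pos_diff /single /=.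
      by rewrite upd_same pi !max_l //; lra.
    by rewrite upd_other // !add0r.
  rewrite (repD T_rep) // adjointEr; last exact: rep_contractive T_rep _ bS.
  by rewrite (Nica_single Sg_semigroup T_rep T_Nica).
exists J, V; split; [split=> // | | ].
- by apply: inner_eq_isometric => h; rewrite /= Phi_gram // /rep_kernel
    (pos_diff0r Sg_semigroup) // !(rep0 T_rep).
- move=> s sS h; apply: orth_proj_range => [|k].
    by apply: inner_eq_isometric => h'; rewrite /= Phi_gram // /rep_kernel
      (pos_diff0r Sg_semigroup) // !(rep0 T_rep).
  rewrite VJ //= Phi_gram // /rep_kernel (pos_diff0r Sg_semigroup) //.
  by rewrite (pos_diff0l Sg_semigroup) // (rep0 T_rep).
- rewrite /minimal_dilation -Phi_total; congr (closure (linear_span _)).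
  apply/seteqP; split=> [_ [s sS [h _ <-]]|_ [[[s sS] h] _ <-]].
    by exists (exist _ s sS, h) => //=; rewrite -[Phi (fun=> 0) h]/(J h) VJ.
  by exists s => //; exists h => //; rewrite VJ.
move=> i j ij s t sm tm.
have sS : S s by rewrite (summand_single sm); exact: direct_sum_single sm.1.
have tS : S t by rewrite (summand_single tm); exact: direct_sum_single tm.1.
have aN s' x : S s' -> hnorm (adjoint (V s') x) <= hnorm x.
  by move=> s'S; rewrite -hnorm_le; exact: adjoint_contractive (VC _ s'S) _.
apply: (Phi_eq (adjoint (V s) \o V t) (V t \o adjoint (V s)))
    => [a x y|a x y|x|x|p h pS] /=.
- by rewrite linearP; exact: adjoint_linear (VC _ sS) _ _ _.
- by rewrite adjoint_linear ?linearP //; exact: VC.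
- by apply: le_trans (aN _ _ sS) _; rewrite VN.
- by rewrite VN // aN.
have VK s' x : S s' -> adjoint (V s') (V s' x) = x.
  move=> s'S; apply: adjoint_unique => [|y]; first exact: VC.
  by rewrite isometric_inner //; exact: VI.
(* If [s i <= p i], then [Phi p h] is in the range of [V s].  Otherwise the part
   [a] of [s] is absorbed by [p], and [Vadj] applies to the rest [b]. *)
have [sp|ps] := leP (s i) (p i).
  have [q [qS ->]] : exists q, S q /\ p = s \+ q.
    exists (upd i (p i - s i) p); split.
      by apply: direct_sum_upd => //; exact: SgB (pS.1 i) sm.1 sp.
    rewrite (summand_single sm); apply: (@eq_at _ _ i) => [|l li].
      by rewrite /= /single !upd_same; ring.
    by rewrite /= /single !upd_other // add0r.
  rewrite -VE // -[V t _](repD V_crep) // [t \+ s](_ : _ = s \+ t).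
    by rewrite (repD V_crep) // !VK.
  by apply/funext => l; rewrite /= addrC.
pose a := single i (p i); pose b := single i (s i - p i).
have bSg : Sg i (s i - p i) by exact: SgB sm.1 (pS.1 i) (ltW ps).
have aS : S a by exact: direct_sum_single (pS.1 i).
have bS : S b by exact: direct_sum_single bSg.
have sE : s = a \+ b.
  by rewrite (summand_single sm) -single_add; congr (single i _); ring.
pose q := upd i 0 p.
have qS : S q by apply: direct_sum_upd => //; exact: Sg0.
have adjE r k : S r -> r i = 0 ->
    adjoint (V s) (Phi (a \+ r) k) = Phi r (adjoint (T b) k).
  move=> rS ri; rewrite sE (rep_adjointD Sg_semigroup V_crep) // -VE // VK //.
  exact: Vadj.
have qi : q i = 0 by rewrite /q upd_same.
have aqS := direct_sumD Sg_semigroup aS qS.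
rewrite (split_coordinate i p) -/a -/q adjE // !VE //.
rewrite [t \+ (a \+ q)](_ : _ = a \+ (t \+ q)).
  rewrite adjE //; first exact: direct_sumD.
  by rewrite /= qi addr0 tm.2.
by apply/funext => l; rewrite /= addrCA.
Qed.

End Existence.

Lemma minimal_Nica_dilation_exists :
  exists (K : hilbertType R) (J : {linear H -> K})
    (V : (I -> R) -> {linear K -> K}), minimal_Nica_dilation Sg T J V.
Proof.
pose k (x y : {s | S s} * H) := rep_kernel T (sval x.1) x.2 (sval y.1) y.2.
have [||K [phi [gram tphi]]] := @kernel_decomposition _ _ k.
- by move=> x y; exact: rep_kernelC.
- move=> n c x.
  have := rep_form_ge0 Sg_semigroup Sg_cone T_rep T_Nica
    (fun a => c a *: (x a).2) (fun a => svalP (x a).1).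
  congr (0 <= _); apply: eq_bigr => a _; apply: eq_bigr => b _.
  by rewrite /k /rep_kernel !linearZ (semiZl hH) (semiZr hH) mulrA.
pose Phi p h := if pselect (S p) is left pS then phi (exist _ p pS, h) else 0.
have PhiE (x : {s | S s} * H) : Phi (sval x.1) x.2 = phi x.
  case: x => [[p pS] h]; rewrite /Phi /=; case: pselect => // pS'.
  by rewrite (Prop_irrelevance pS' pS).
have [||J [V hV]] := @minimal_Nica_dilation_of_kernel K Phi.
- move=> p h q k' pS qS.
  by have := gram (exist _ p pS, h) (exist _ q qS, k'); rewrite -!PhiE.
- by rewrite (_ : (fun x => _) = phi) //; apply/funext.
by exists K, J, V.
Qed.

End MinimalNicaDilation.

Theorem theorem2p5 (R : realType) (I : Type) (Sg : I -> set R)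
  (H : hilbertType R) (T : (I -> R) -> {linear H -> H}) :
  (forall i, subsemigroup (Sg i)) ->
  positive_cone Sg ->
  contractive_rep Sg T ->
  Nica_covariant Sg T ->
  (exists (K : hilbertType R) (J : {linear H -> K})
     (V : (I -> R) -> {linear K -> K}), minimal_Nica_dilation Sg T J V) /\
  (forall (K1 K2 : hilbertType R)
     (J1 : {linear H -> K1}) (J2 : {linear H -> K2})
     (V : (I -> R) -> {linear K1 -> K1}) (W : (I -> R) -> {linear K2 -> K2}),
     minimal_Nica_dilation Sg T J1 V -> minimal_Nica_dilation Sg T J2 W ->
     exists U : {linear K1 -> K2},
       [/\ unitary U, forall h, U (J1 h) = J2 h &
           forall s, direct_sum Sg s -> forall x, U (V s x) = W s (U x)]).
Proof.
move=> Sg_semigroup Sg_cone T_rep T_Nica; split.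
  exact: minimal_Nica_dilation_exists.
exact: minimal_Nica_dilation_unique.
Qed.
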